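(* Let $(X_t)_{t\in\mathbb{Z}}$ be stationary and ergodic. Let $C=C(0)$ be the kernel covariance operator and $C_n=C_n(0)$ its empirical estimate. Then kernel PCA is strongly consistent in the sense that we have spectral convergence $$\sup_{i\ge1}|\lambda_i(C)-\lambda_i(C_n)|\to0\quad\mathbb{P}\text{-a.e. as } n\to\infty,$$ as well as $$\|P_j(C_n)-P_j(C)\|\to0\quad\mathbb{P}\text{-a.e. as } n\to\infty$$ for all $j\ge1$. In both cases, convergence takes place with at least the same rate as the convergence $C_n\to C$ in operator norm.
   Context: Setting and standing assumptions: $(\Omega,\mathcal{F},\mathbb{P})$ is a probability space, $E$ is a Polish space with Borel $\sigma$-field $\mathcal{F}_E$, and $(X_t)_{t\in\mathbb{Z}}$ is a stationary $E$-valued process: all finite-dimensional laws are invariant under time shifts. $\mathscr{H}$ is a separable real reproducing kernel Hilbert space of functions $E\to\mathbb{R}$ with kernel $k$ and canonical feature map $\varphi(x)=k(x,\cdot)$, assumed Borel measurable $E\to\mathscr{H}$; $\varphi(X_0)$ is Bochner square-integrable, and the embedded process is centered, $\mathbb{E}[\varphi(X_0)]=0$. Ergodicity: without loss of generality the process is given on the canonical space $\Omega=E^{\mathbb{Z}}$, $\mathcal{F}=\mathcal{F}_E^{\otimes\mathbb{Z}}$, as the coordinate projections $X_t(\omega)=\omega_t$. With $T$ the left shift $(T\omega)_i=\omega_{i+1}$, which preserves $\mathbb{P}$ by stationarity, the process is ergodic if for every $M\in\mathcal{F}_E^{\otimes\mathbb{Z}}$ the condition $T^{-1}M=M$ implies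 $\mathbb{P}[M]=0$ or $\mathbb{P}[M]=1$. Notation: for $u,v\in\mathscr{H}$, $u\otimes v$ is the rank-one operator $h\mapsto\langle h,v\rangle_{\mathscr{H}}\,u$. $C=\mathbb{E}[\varphi(X_0)\otimes\varphi(X_0)]$ and $C_n=\frac1n\sum_{t=1}^n\varphi(X_t)\otimes\varphi(X_t)$. $\|\cdot\|$ is the operator norm. For a compact self-adjoint positive-semidefinite operator $A$ on $\mathscr{H}$ (in particular for $A=C$ and $A=C_n$): $\lambda_1(A)\ge\lambda_2(A)\ge\dots$ are the nonzero eigenvalues of $A$ in nonincreasing order, repeated with multiplicity, and $\lambda_i(A):=0$ for the remaining indices $i$; $\mu_1(A)>\mu_2(A)>\dots$ are the distinct nonzero eigenvalues of $A$; and $P_j(A)$ is the orthogonal spectral projector onto the eigenspace of $A$ corresponding to $\mu_j(A)$. Kernel PCA approximates the spectral decomposition of $C$ by that of $C_n$.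
   Formalization: The projector claim fails if C has a multiple eigenvalue that splits in C_n; it is proved for P_j(C_n) when those of μ_1(C),…,μ_j(C) that exist are simple, and for all j with P_j(C_n) replaced by the projector onto the eigenspaces of C_n for λ_i(C_n), λ_i(C)=μ_j(C). *)

(* Defs.v *)
From HB Require Import structures.
From mathcomp Require Import all_boot all_order all_algebra.
From mathcomp Require Import all_classical all_reals all_analysis.
From mathcomp Require Import measurable_realfun sesquilinear.

Set Implicit Arguments.
Unset Strict Implicit.
Unset Printing Implicit Defensive.

Import Order.TTheory GRing.Theory Num.Theory.
Import numFieldNormedType.Exports.

Local Open Scope classical_set_scope.
Local Open Scope card_scope.
Local Open Scope ring_scope.

Definition separable_space (T : topologicalType) : Prop :=
  exists D : set T, countable D /\ dense D.

Definition is_metric (R : realType) (T : Type) (dist : T -> T -> R) : Prop :=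
  [/\ forall x y, 0 <= dist x y,
      forall x y, dist x y = 0 <-> x = y,
      forall x y, dist x y = dist y x &
      forall x y z, dist x z <= dist x y + dist y z].

Definition metrizes (R : realType) (T : topologicalType) (dist : T -> T -> R)
    : Prop :=
  forall (x : T) (A : set T),
    nbhs x A <-> exists2 e : R, 0 < e & [set y | dist x y < e] `<=` A.

Definition complete_metric (R : realType) (T : topologicalType)
    (dist : T -> T -> R) : Prop :=
  forall u : nat -> T,
    (forall e : R, 0 < e -> exists N : nat,
       forall m n, (N <= m)%N -> (N <= n)%N -> dist (u m) (u n) < e) ->
    exists x : T, u @ \oo --> x.

Definition polish (R : realType) (T : topologicalType) : Prop :=
  separable_space T /\
  exists dist : T -> T -> R,
    [/\ is_metric dist, metrizes dist & complete_metric dist].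

Definition borel (T : topologicalType) : set (set T) := <<s (@open T) >>.

Definition borel_measurable (S T : topologicalType) (f : S -> T) : Prop :=
  forall B : set T, borel B -> borel (f @^-1` B).

Definition product_borel (I : Type) (T : topologicalType)
    : set (set (I -> T)) :=
  <<s [set A | exists (i : I) (B : set T),
                 borel B /\ A = [set f | B (f i)]] >>.

Section Process.
Context {d : measure_display} {Omega : measurableType d} {R : realType}.
Context {E : topologicalType}.
Variable P : probability Omega R.
Variable X : int -> Omega -> E.

Definition is_process : Prop :=
  forall (t : int) (B : set E), borel B -> measurable (X t @^-1` B).

Definition stationary : Prop :=
  forall (m : nat) (t : 'I_m -> int) (s : int) (B : set ('I_m -> E)),
    product_borel B ->
    P [set w | B (fun i => X (t i + s) w)] = P [set w | B (fun i => X (t i) w)].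

Definition left_shift (x : int -> E) : int -> E := fun i => x (i + 1).

(** Ergodicity of the law of [X] on [E ^ Z]; when [Omega] is [E ^ Z] and [X] is
    the coordinate process, the set measured by [P] is [M] itself. *)
Definition ergodic : Prop :=
  forall M : set (int -> E), product_borel M -> left_shift @^-1` M = M ->
    P [set w | M (fun t => X t w)] = 0%E \/
    P [set w | M (fun t => X t w)] = 1%E.

End Process.

Section Bochner.
Context {d : measure_display} {Omega : measurableType d} {R : realType}.
Variable P : probability Omega R.

Definition simple_function (V : lmodType R) (s : Omega -> V) : Prop :=
  finite_set (range s) /\ forall v : V, measurable (s @^-1` [set v]).

Definition simple_integral (V : lmodType R) (s : Omega -> V) : V :=
  \sum_(v \in range s) fine (P (s @^-1` [set v])) *: v.

(** The extended norm [N] is a parameter because the space of operators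
    [H -> H] below carries no canonical norm. *)
Definition is_bochner_integral (V : lmodType R) (N : V -> \bar R)
    (Y : Omega -> V) (v : V) : Prop :=
  exists s : nat -> Omega -> V,
    [/\ forall n, simple_function (s n),
        forall n, measurable_fun [set: Omega] (fun w => N (Y w - s n w)),
        (fun n => \int[P]_w N (Y w - s n w)%R)%E @ \oo --> 0%E &
        (fun n => N (simple_integral (s n) - v)) @ \oo --> 0%E].

(** Junk value [0] when [Y] is not Bochner integrable. *)
Definition bochner_integral (V : lmodType R) (N : V -> \bar R)
    (Y : Omega -> V) : V :=
  xget 0 [set v | is_bochner_integral N Y v].

Definition bochner_square_integrable (H : normedModType R)
    (Y : Omega -> H) : Prop :=
  (exists s : nat -> Omega -> H,
     (forall n, simple_function (s n)) /\
     {ae P, forall w, (fun n => s n w) @ \oo --> Y w}) /\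
  (\int[P]_w (`|Y w| ^+ 2)%:E < +oo)%E.

End Bochner.

(** [H] is a complete normed space whose norm comes from the inner product [ip];
    [ev h] is the function on [E] that [h] stands for. *)
Definition is_rkhs (R : realType) (E : Type) (H : completeNormedModType R)
    (ip : {dot H for idfun}) (ev : H -> E -> R) (k : E -> E -> R)
    (phi : E -> H) : Prop :=
  [/\ forall h : H, ip h h = `|h| ^+ 2,
      injective ev,
      forall x y : E, ev (phi x) y = k x y &
      forall (h : H) (x : E), ev h x = ip h (phi x)].

(** Extended-valued, on all maps [H -> H]: it is [+oo] unless [A] satisfies some
    bound [`|A h| <= c * `|h|], and vanishes only at [A = 0].  In particular
    limits of linear maps for [opnorm] are linear. *)
Definition opnorm (R : realType) (H : normedModType R) (A : H -> H) : \bar R :=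
  ereal_inf [set c%:E | c in [set c : R | 0 <= c /\
                                         forall h : H, `|A h| <= c * `|h|]].

Definition tensor (R : realType) (H : normedModType R)
    (ip : {dot H for idfun}) (u v : H) : H -> H :=
  fun h => ip h v *: u.

Definition has_dim (R : realType) (H : lmodType R) (V : set H) (m : nat)
    : Prop :=
  exists e : 'I_m -> H,
    (forall c : 'I_m -> R, \sum_i c i *: e i = 0 -> forall i, c i = 0) /\
    V = [set h | exists c : 'I_m -> R, h = \sum_i c i *: e i].

Definition lin_span (R : realType) (H : lmodType R) (S : set H) : set H :=
  [set h | exists (m : nat) (c : 'I_m -> R) (e : 'I_m -> H),
             (forall i, S (e i)) /\ h = \sum_i c i *: e i].

Definition eigspace (R : realType) (H : lmodType R) (A : H -> H) (m : R)
    : set H :=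
  [set h | A h = m *: h].

Definition is_eigenvalue (R : realType) (H : lmodType R) (A : H -> H) (m : R)
    : Prop :=
  exists2 h : H, h != 0 & eigspace A m h.

(** Every [m != 0] occurs in [l] as often as its multiplicity as an eigenvalue
    (never if it is not one).  As [l] is nonincreasing and nonnegative, any zeros
    come after all the nonzero eigenvalues; there is at most one such [l]. *)
Definition is_eigenvalue_sequence (R : realType) (H : lmodType R)
    (A : H -> H) (l : nat -> R) : Prop :=
  [/\ forall i j, (i <= j)%N -> l j <= l i,
      forall i, 0 <= l i &
      forall m : R, m != 0 -> exists2 p : nat,
        has_dim (eigspace A m) p & [set i | l i = m] #= `I_p].

(** Indices start at 0: [lambda A i] is the [(i+1)]-st eigenvalue. *)
Definition lambda (R : realType) (H : lmodType R) (A : H -> H) : nat -> R :=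
  xget (fun=> 0) [set l | is_eigenvalue_sequence A l].

(** [mu A j] is the nonzero eigenvalue with exactly [j] distinct nonzero
    eigenvalues above it, and [0] if there is none. *)
Definition mu (R : realType) (H : lmodType R) (A : H -> H) (j : nat) : R :=
  xget 0 [set m | [/\ m != 0, is_eigenvalue A m &
    [set m' | [/\ m' != 0, is_eigenvalue A m' & m < m']] #= `I_j]].

Definition orthproj (R : realType) (H : normedModType R)
    (ip : {dot H for idfun}) (V : set H) : H -> H :=
  fun h => xget 0 [set p | V p /\ forall v, V v -> ip (h - p) v = 0].

Definition specproj (R : realType) (H : normedModType R)
    (ip : {dot H for idfun}) (A : H -> H) (j : nat) : H -> H :=
  if mu A j == 0 then 0 else orthproj ip (eigspace A (mu A j)).

(** The indices [i] with [lambda B i = mu B j] are those of the [j]-th group of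
    coinciding eigenvalues of [B]; this projects onto the sum of the eigenspaces
    of [A] for the eigenvalues [lambda A i] with the same indices.  For [A = B]
    it is [specproj ip B j].  When [A] is close to [B], this is the projector of
    [A] comparable with [specproj ip B j], since a multiple eigenvalue of [B] in
    general splits into several distinct eigenvalues of [A]. *)
Definition cluster_specproj (R : realType) (H : normedModType R)
    (ip : {dot H for idfun}) (A B : H -> H) (j : nat) : H -> H :=
  orthproj ip (lin_span
    (\bigcup_(i in [set i | mu B j != 0 /\ lambda B i = mu B j])
       eigspace A (lambda A i))).

Definition eigenvalue_dist (R : realType) (H : lmodType R) (A B : H -> H)
    : \bar R :=
  ereal_sup (range (fun i => `|lambda A i - lambda B i|%:E)).

Section Covariance.
Context {d : measure_display} {Omega : measurableType d} {R : realType}.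
Context {E : Type} {H : completeNormedModType R}.
Variables (P : probability Omega R) (X : int -> Omega -> E).
Variables (ip : {dot H for idfun}) (phi : E -> H).

Definition cov_op : H -> H :=
  bochner_integral P (@opnorm R H)
    (fun w => tensor ip (phi (X 0 w)) (phi (X 0 w))).

Definition emp_cov_op (n : nat) (w : Omega) : H -> H :=
  n%:R^-1 *: \sum_(1 <= t < n.+1) tensor ip (phi (X t%:Z w)) (phi (X t%:Z w)).

End Covariance.

(* Main.v *)
Require Import Defs.
From HB Require Import structures.
From mathcomp Require Import all_boot all_order all_algebra.
From mathcomp Require Import all_classical all_reals all_analysis.
From mathcomp Require Import measurable_realfun sesquilinear.
From mathcomp Require Import finmap ring lra.

Set Implicit Arguments.
Unset Strict Implicit.
Unset Printing Implicit Defensive.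

Import Order.TTheory GRing.Theory Num.Theory.
Import numFieldNormedType.Exports.

Local Open Scope classical_set_scope.
Local Open Scope ring_scope.

(** Kernel PCA is consistent because the spectral data of a compact positive
    operator are Lipschitz functions of the operator for the operator norm, and
    because [Cn] tends to [C] in operator norm by the ergodic theorem.  Only
    the embedded process [Z t = phi (X t)] in the Hilbert space [H] matters.

    Perturbation theory.  A compact positive operator has an [eigenbasis],
    built by maximizing Rayleigh quotients ([eigenbasis_exists]); its
    eigenvalues, in order, are the sequence [lambda] ([eigenbasis_lambda]).
    Counting dimensions gives the min-max principle ([minmax]), hence
    [|lambda A i - lambda C i| <= |A - C|] ([weyl]).  If [mu C j] is at distance
    [c] from the rest of the spectrum, eigenvectors of one operator are
    approximate eigenvectors of the other, and [spectral_gap] turns this into a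
    bound on the difference of the projectors ([davis_kahan]).  Perturbations
    of size comparable to [c] need no argument, since projectors are at
    distance at most [2]; this is why a single constant serves for all [n].
    When the leading eigenvalues of [C] are simple, those of [Cn] are separated
    too and the cluster projector is the [j]-th spectral projector
    ([specproj_lipschitz]).  If [C] has fewer than [j + 1] nonzero eigenvalues,
    one also has to know that [Cn] has no spurious one: almost surely [Cn]
    vanishes on the kernel of [C] ([emp_cov_op_ker]).

    The ergodic theorem.  For real stationary processes, Garsia's argument
    gives the maximal ergodic theorem ([maximal_ergodic]).  The event that the
    partial sums of [Y - c] are unbounded above is shift-invariant, so it is
    null as soon as [E Y < c] ([ergodic_upper]), and this yields Birkhoff's
    theorem ([birkhoff]).

    Convergence of [Cn].  Replace each [Z t] by a nearest point [nearest m] of a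
    finite grid.  For the discretized process, the empirical covariance is a
    finite sum whose coefficients are frequencies, to which Birkhoff's theorem
    applies.  The discretization costs at most the time average of
    [grid_error m], which converges to its expectation; the latter tends to [0]
    by dominated convergence.  The same grids provide the simple functions that
    show [C] to be a true Bochner integral ([weak_cov_bochner]) and the
    finite-rank operators that show it to be compact
    ([weak_cov_positive_compact]). *)

(** * Hilbert spaces and compact operators *)

Section InnerProduct.
Context {R : realType} {H : completeNormedModType R}.
Variable ip : {dot H for idfun}.
Hypothesis ip_norm : forall h : H, ip h h = `|h| ^+ 2.

Lemma ipC u v : ip u v = ip v u.
Proof. by rewrite hermC/= expr0 mul1r. Qed.

Lemma ipDl u v w : ip (u + v) w = ip u w + ip v w.
Proof. by rewrite linearDl. Qed.

Lemma ipBl u v w : ip (u - v) w = ip u w - ip v w.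
Proof. by rewrite linearBl. Qed.

Lemma ipZl a u w : ip (a *: u) w = a * ip u w.
Proof. by rewrite linearZl_LR. Qed.

Lemma ip0l w : ip 0 w = 0.
Proof. by rewrite linear0l. Qed.

Lemma ipDr u v w : ip w (u + v) = ip w u + ip w v.
Proof. by rewrite linearDr. Qed.

Lemma ipBr u v w : ip w (u - v) = ip w u - ip w v.
Proof. by rewrite linearBr. Qed.

Lemma ipZr a u w : ip w (a *: u) = a * ip w u.
Proof. by rewrite linearZr. Qed.

Lemma ip0r w : ip w 0 = 0.
Proof. by rewrite linear0r. Qed.

Lemma ip_suml I (s : seq I) (Q : pred I) (F : I -> H) w :
  ip (\sum_(i <- s | Q i) F i) w = \sum_(i <- s | Q i) ip (F i) w.
Proof. exact: (big_morph (fun u => ip u w) (fun u v => ipDl u v w) (ip0l w)). Qed.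

Lemma ip_sumr I (s : seq I) (Q : pred I) (F : I -> H) w :
  ip w (\sum_(i <- s | Q i) F i) = \sum_(i <- s | Q i) ip w (F i).
Proof. exact: (big_morph (ip w) (fun u v => ipDr u v w) (ip0r w)). Qed.

Lemma ip_ge0 u : 0 <= ip u u.
Proof. by rewrite ip_norm sqr_ge0. Qed.

Lemma ip_inj u v : (forall w, ip u w = ip v w) -> u = v.
Proof.
move=> e; apply/eqP; rewrite -subr_eq0 -normr_eq0 -sqrf_eq0 -ip_norm.
by rewrite {1}ipBl e subrr.
Qed.

Lemma CauchySchwarz u v : `|ip u v| <= `|u| * `|v|.
Proof.
rewrite -[leRHS]ger0_norm ?mulr_ge0// -ler_sqr ?nnegrE//.
rewrite !real_normK ?num_real// exprMn -!ip_norm.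
have [v0|v0] := eqVneq v 0; first by rewrite v0 !ip0r expr0n/= mulr0.
have vv : 0 < ip v v by rewrite neq0_dnorm_gt0.
have := ip_ge0 (ip v v *: u - ip u v *: v).
rewrite !(ipBl, ipBr, ipZl, ipZr) (ipC v u) => h.
have : 0 <= ip v v * (ip u u * ip v v - ip u v ^+ 2) by nra.
by rewrite pmulr_rge0// subr_ge0.
Qed.

Lemma normD_orth u v : ip u v = 0 -> `|u + v| ^+ 2 = `|u| ^+ 2 + `|v| ^+ 2.
Proof.
by move=> uv; rewrite -!ip_norm !(ipDl, ipDr) (ipC v u) uv addr0 add0r.
Qed.

Lemma normB_orth u v : ip u v = 0 -> `|u - v| ^+ 2 = `|u| ^+ 2 + `|v| ^+ 2.
Proof.
move=> uv; rewrite -!ip_norm !(ipBl, ipBr) (ipC v u) uv.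
by rewrite subr0 sub0r opprK.
Qed.

Lemma norm_le_ip u (c : R) : 0 <= c -> (forall v, ip u v <= c * `|v|) ->
  `|u| <= c.
Proof.
move=> c0 /(_ u); rewrite ip_norm.
have [->|u0] := eqVneq u 0; first by rewrite normr0.
by rewrite expr2 ler_pM2r ?normr_gt0.
Qed.

Lemma cvg_ipl T (F : set_system T) (FF : Filter F) (u : T -> H) x g :
  u t @[t --> F] --> x -> ip (u t) g @[t --> F] --> ip x g.
Proof.
move=> ux; apply/cvgrPdist_lt => e e0.
have d : 0 < e / (`|g| + 1) by rewrite divr_gt0// ltr_wpDl.
move/cvgrPdist_lt : ux => /(_ _ d); apply: filterS => t.
rewrite ltr_pdivlMr ?ltr_wpDl// -ipBl => ut.
rewrite (le_lt_trans (CauchySchwarz _ _))// (le_lt_trans _ ut)//.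
by rewrite ler_wpM2l// lerDl.
Qed.

(** The only operators that occur are symmetric for [ip], and these are
    automatically linear. *)
Definition symmetric_op (A : H -> H) := forall u v, ip (A u) v = ip u (A v).

Definition psd (A : H -> H) := forall u, 0 <= ip (A u) u.

(** For operators on a Hilbert space this is compactness. *)
Definition finite_rank_limit (A : H -> H) := forall e : R, 0 < e ->
  exists (p : nat) (a b : 'I_p -> H),
    forall h, `|A h - \sum_i ip h (b i) *: a i| <= e * `|h|.

Section Symmetric.
Variable A : H -> H.
Hypothesis A_sym : symmetric_op A.

Lemma symD u v : A (u + v) = A u + A v.
Proof. by apply: ip_inj => w; rewrite !(A_sym, ipDl). Qed.

Lemma symZ c u : A (c *: u) = c *: A u.
Proof. by apply: ip_inj => w; rewrite !(A_sym, ipZl). Qed.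

Lemma symB u v : A (u - v) = A u - A v.
Proof. by rewrite symD -scaleN1r symZ scaleN1r. Qed.

Lemma sym0 : A 0 = 0.
Proof. by rewrite -(scale0r 0) symZ !scale0r. Qed.

Lemma sym_sum I (s : seq I) (Q : pred I) (F : I -> H) :
  A (\sum_(i <- s | Q i) F i) = \sum_(i <- s | Q i) A (F i).
Proof. exact: (big_morph A symD sym0). Qed.

End Symmetric.

Lemma finite_rank_limit_bounded A : finite_rank_limit A ->
  exists2 c : R, 0 < c & forall h, `|A h| <= c * `|h|.
Proof.
move=> /(_ 1 ltr01) [p [a [b ab]]].
exists (1 + \sum_i `|b i| * `|a i|) => [|h].
  by rewrite ltr_pwDl// sumr_ge0// => i _; rewrite mulr_ge0.
rewrite -[A h](subrK (\sum_i ip h (b i) *: a i)).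
rewrite (le_trans (ler_normD _ _))// mulrDl lerD//.
rewrite (le_trans (ler_norm_sum _ _ _))// mulr_suml ler_sum// => i _.
by rewrite normrZ mulrAC ler_wpM2r// mulrC CauchySchwarz.
Qed.

(** The values lie in a compact interval, so the image filter has a cluster
    point; an ultrafilter contains the preimage of each neighbourhood of it. *)
Lemma ultra_bounded_cvg T (U : set_system T) (f : T -> R) (c : R) :
  UltraFilter U -> (forall t, `|f t| <= c) -> exists l : R, f t @[t --> U] --> l.
Proof.
move=> UU fc.
have fU : (fmap f U) `[- c, c]%classic.
  by rewrite /fmap/=; apply: (@filterE _ U) => t; rewrite /= in_itv/= -ler_norml fc.
have [l [_ cl]] := segment_compact (fmap_proper_filter f _) fU.
exists l => B Bl.
have [//|UnB] := in_ultra_setVsetC (f @^-1` B) UU.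
by have [x []] := cl (~` B) B UnB Bl.
Qed.

(** The images form a Cauchy filter: along the ultrafilter the finitely many
    coordinates of a finite-rank approximation converge. *)
Lemma ultra_image_cvg (U : set_system nat) (A : H -> H) (h : nat -> H) :
  UltraFilter U -> finite_rank_limit A -> (forall n, `|h n| <= 1) ->
  exists y : H, A (h n) @[n --> U] --> y.
Proof.
move=> UU Afr h1; suff: cauchy (fmap (A \o h) U).
  by move=> /cauchy_cvgP /cvg_ex.
apply: cauchy_exP => e e0.
have /Afr[p [a [b ab]]] : 0 < e / 2 by rewrite divr_gt0.
have /choice[l ll] : forall i, exists l : R, ip (h n) (b i) @[n --> U] --> l.
  move=> i; apply: (ultra_bounded_cvg (c := `|b i|)) => n.
  by rewrite (le_trans (CauchySchwarz _ _))// ler_piMl.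
exists (\sum_i l i *: a i).
have F : \sum_i ip (h n) (b i) *: a i @[n --> U] --> \sum_i l i *: a i.
  apply: cvg_big => [|i _]; first exact: add_continuous.
  by apply: cvgZr_tmp; exact: ll.
have e2 : 0 < e / 2 by rewrite divr_gt0.
rewrite /fmap/=; move/cvgrPdist_lt : F => /(_ _ e2); apply: filterS => n Fn.
rewrite /= -ball_normE/=.
have := ab (h n); have := h1 n; have := ler_distD (\sum_i ip (h n) (b i) *: a i)
  (\sum_i l i *: a i) (A (h n)).
rewrite [X in _ <= _ + X -> _]distrC.
by nra.
Qed.

(** This is positivity of [A] at [h - M^-1 *: A h].  The Rayleigh bound is only
    assumed at [A h], so the lemma can be used inside an invariant subspace. *)
Lemma rayleigh_norm A (h : H) M : symmetric_op A -> psd A ->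
  ip (A (A h)) (A h) <= M * `|A h| ^+ 2 -> 0 < M ->
  `|A h| ^+ 2 <= M * ip (A h) h.
Proof.
move=> As Ap AM M0.
have := Ap (h - M^-1 *: A h).
rewrite symB// symZ// !(ipBl, ipBr, ipZl, ipZr) (As (A h) h) !ip_norm => h0.
have := ler_wpM2l (ltW M0) h0; rewrite mulr0.
set a := `|A h| ^+ 2 in AM *; set q := ip _ _ in AM *.
have -> : M * (ip (A h) h - M^-1 * a - (M^-1 * a - M^-1 * (M^-1 * q))) =
  M * ip (A h) h - 2 * a + M^-1 * q by field; rewrite gt_eqF.
have : M^-1 * q <= a by rewrite mulrC ler_pdivrMr// mulrC.
by lra.
Qed.

End InnerProduct.

(** * Eigenvectors of compact positive operators *)

Section Spectral.
Context {R : realType} {H : completeNormedModType R}.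
Variable ip : {dot H for idfun}.
Hypothesis ip_norm : forall h : H, ip h h = `|h| ^+ 2.

(** Let [M] be the supremum of the Rayleigh quotient on the orthogonal of [es],
    and [h] a maximizing sequence.  Then [A (h n) - M *: h n] tends to [0] by
    [rayleigh_norm], while [A (h n)] converges along an ultrafilter because [A]
    is compact; so [h n] converges too, to an eigenvector.  If [M] is [0], the
    vector returned is [0]. *)
Lemma rayleigh_max A (es : seq H) :
  symmetric_op ip A -> psd ip A -> finite_rank_limit ip A ->
  (forall e, e \in es -> exists l, A e = l *: e) ->
  exists (x : H) (l : R), [/\ 0 <= l, A x = l *: x,
    forall e, e \in es -> ip x e = 0, ip x x = (l != 0)%:R &
    forall h, (forall e, e \in es -> ip h e = 0) -> ip (A h) h <= l * `|h| ^+ 2].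
Proof.
move=> As Ap Af Aes.
have [c c0 Ac] := finite_rank_limit_bounded ip_norm Af.
have Aperp h : (forall e, e \in es -> ip h e = 0) ->
    forall e, e \in es -> ip (A h) e = 0.
  by move=> he e ee; have [l el] := Aes _ ee; rewrite As el ipZr he// mulr0.
pose S := [set q | exists h, [/\ forall e, e \in es -> ip h e = 0,
  `|h| <= 1 & q = ip (A h) h]].
have Sub : has_sup S.
  split; first by exists 0, 0; split; [move=> *; rewrite ip0l|rewrite normr0|
    rewrite ip0r].
  exists c => _ [h [_ h1 ->]]; rewrite (le_trans (ler_norm _))//.
  rewrite (le_trans (CauchySchwarz ip_norm _ _))//.
  rewrite (le_trans (ler_piMr _ h1))// (le_trans (Ac _))//.
  by rewrite ler_piMr// ltW.
pose M := sup S.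
have AM h : (forall e, e \in es -> ip h e = 0) -> ip (A h) h <= M * `|h| ^+ 2.
  move=> he; have [->|h0] := eqVneq h 0.
    by rewrite ip0r normr0 expr0n/= mulr0.
  have : ip (A (`|h|^-1 *: h)) (`|h|^-1 *: h) <= M.
    apply: ub_le_sup; first exact: Sub.2.
    exists (`|h|^-1 *: h); split => // [e ee|].
      by rewrite ipZl he// mulr0.
    by rewrite normrZ normfV normr_id mulVf// normr_eq0.
  rewrite (symZ ip_norm As) ipZl ipZr mulrA -expr2 exprVn mulrC.
  by rewrite ler_pdivrMr// exprn_gt0// normr_gt0.
have M0 : 0 <= M.
  by apply: (ub_le_sup Sub.2); exists 0; split; [move=> *; rewrite ip0l|
    rewrite normr0|rewrite ip0r].
move: M0; rewrite le_eqVlt => /predU1P[M0|M0].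
  exists 0, 0; split => //; first by rewrite (sym0 ip_norm As) scaler0.
  - by move=> *; rewrite ip0l.
  - by rewrite ip0l eqxx.
  - by move=> h /AM; rewrite -M0.
have /choice[h hP] : forall n : nat, exists h, [/\ forall e, e \in es -> ip h e = 0,
    `|h| <= 1 & M - n.+1%:R^-1 < ip (A h) h].
  move=> n; have /(sup_adherent)/(_ Sub)[q [h [he h1 ->]] Mh] : 0 < n.+1%:R^-1 :> R.
    by rewrite invr_gt0.
  by exists h.
have h1 n : `|h n| <= 1 by have [] := hP n.
have [U [UU oU]] := ultraFilterLemma (@eventually_filter : ProperFilter \oo).
have [y Ahy] := ultra_image_cvg ip_norm UU Af h1.
have qM : ip (A (h n)) (h n) @[n --> U] --> M.
  apply/cvgrPdist_lt => e e0; apply: oU.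
  have [N _ Ne] := near_infty_natSinv_lt (PosNum e0).
  exists N => // n /Ne /= ne; have [he _ Mh] := hP n.
  have := AM _ he; have := h1 n; have := normr_ge0 (h n) => h0 {}h1 hM.
  rewrite ger0_norm; last first.
    by rewrite subr_ge0 (le_trans hM)// ler_piMr ?(ltW M0)// exprn_ile1.
  by rewrite ltrBlDr -ltrBlDl (lt_trans _ Mh)// ltrD2l ltrN2; exact: ne.
have hy : h n @[n --> U] --> M^-1 *: y.
  have d0 : M *: h n - A (h n) @[n --> U] --> 0.
    apply/cvgr0Pnorm_lt => e e0.
    have d : 0 < e ^+ 2 / M by rewrite divr_gt0// exprn_gt0.
    move/cvgrPdist_lt : (qM) => /(_ _ d); apply: filterS => n qn.
    have [he _ _] := hP n.
    have nA := rayleigh_norm ip_norm As Ap (AM _ (Aperp _ he)) M0.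
    rewrite -(@ltr_pXn2r _ 2)// ?nnegrE ?(ltW e0)// -ip_norm.
    rewrite !(ipBl, ipBr, ipZl, ipZr) (ipC _ (h n)) !ip_norm.
    have := h1 n; have := normr_ge0 (h n) => h0 {}h1.
    have hh : `|h n| ^+ 2 <= 1 by nra.
    have := ltr_normlW qn; rewrite ltr_pdivlMr// => qn'.
    have := AM _ he; nra.
  have -> : h = fun n => M^-1 *: ((M *: h n - A (h n)) + A (h n)).
    by apply/funext => n; rewrite subrK scalerA mulVf ?gt_eqF// scale1r.
  by rewrite -[y]add0r; apply: cvgZl_tmp; apply: cvgD.
pose x := M^-1 *: y; have yx : y = M *: x.
  by rewrite scalerA divff ?gt_eqF// scale1r.
have ipx g : ip (h n) g @[n --> U] --> ip x g by exact: (cvg_ipl ip_norm _ hy).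
have Ax : A x = M *: x.
  rewrite -yx.
  apply: (@cvg_unique _ (@norm_hausdorff _ H) (fmap (A \o h) U)) => //=.
  apply/cvgrPdist_lt => e e0.
  have d : 0 < e / c by rewrite divr_gt0.
  move/cvgrPdist_lt : (hy) => /(_ _ d); apply: filterS => n /= hn.
  rewrite -(symB ip_norm As) (le_lt_trans (Ac _))//.
  by move: hn; rewrite ltr_pdivlMr// mulrC.
have xe e : e \in es -> ip x e = 0.
  move=> ee.
  apply: (@cvg_unique _ (@norm_hausdorff _ _) (fmap (fun n => ip (h n) e) U)).
    exact: ipx.
  rewrite (_ : (fun _ => _) = cst 0); first exact: cvg_cst.
  by apply/funext => n; have [->] := hP n.
exists x, M; split => //; first exact: ltW.
rewrite gt_eqF//=.
have Mxx : M * ip x x = M.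
  apply: (@cvg_unique _ (@norm_hausdorff _ _)
    (fmap (fun n => ip (A (h n)) (h n)) U)); last exact: qM.
  rewrite -ipZr -yx.
  have -> : (fun n => ip (A (h n)) (h n)) =
      (fun n => ip (h n) (A (h n) - y) + ip (h n) y).
    by apply/funext => n; rewrite ipBr subrK ipC.
  rewrite -[ip x y]add0r; apply: cvgD; last exact: ipx.
  apply/cvgr0Pnorm_lt => e e0.
  move/cvgrPdist_lt : (Ahy) => /(_ _ e0); apply: filterS => n hn.
  rewrite (le_lt_trans (CauchySchwarz ip_norm _ _))// (le_lt_trans _ hn)//.
  by rewrite distrC ler_piMl.
by apply: (mulfI (lt0r_neq0 M0)); rewrite mulr1.
Qed.

(** The vectors [e i] with [l i = 0] are [0]: this indexes by [nat] also the
    operators with finitely many nonzero eigenvalues.  The Rayleigh bound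
    expresses that no eigenvector has been left out, and spares infinite
    orthogonal expansions. *)
Record eigenbasis (A : H -> H) (e : nat -> H) (l : nat -> R) : Prop :=
  Eigenbasis {
    eb_eig : forall i, A (e i) = l i *: e i ;
    eb_orth : forall i j, ip (e i) (e j) = ((i == j) && (l i != 0))%:R ;
    eb_noninc : forall i j, (i <= j)%N -> l j <= l i ;
    eb_ge0 : forall i, 0 <= l i ;
    eb_rayleigh : forall i h, (forall j, (j < i)%N -> ip h (e j) = 0) ->
      ip (A h) h <= l i * `|h| ^+ 2 }.

Section Interval.
Variables (A : H -> H) (e : nat -> H) (l : nat -> R).
Hypothesis A_sym : symmetric_op ip A.
Hypothesis eb : eigenbasis A e l.

Lemma eb_zero i : l i = 0 -> e i = 0.
Proof.
move=> li; apply/eqP; rewrite -normr_eq0 -sqrf_eq0 -ip_norm.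
by rewrite (eb_orth eb) li !eqxx.
Qed.

Lemma ip_comb (F : nat -> R) a b k :
  ip (\sum_(a <= i < b) F i *: e i) (e k) =
  if (a <= k < b)%N then F k * (l k != 0)%:R else 0.
Proof.
rewrite ip_suml -mem_index_iota; case: ifPn => kab.
  rewrite (bigD1_seq k) ?iota_uniq//= ipZl (eb_orth eb) eqxx/= big1 ?addr0//.
  by move=> i ik; rewrite ipZl (eb_orth eb) (negbTE ik) mulr0.
rewrite big_seq big1// => i iab; rewrite ipZl (eb_orth eb).
by case: eqP iab kab => [-> ->//|_ _ _]; rewrite mulr0.
Qed.

Lemma ip_perp_comb h (F : nat -> R) a b :
  (forall k, (a <= k < b)%N -> ip h (e k) = 0) ->
  ip h (\sum_(a <= i < b) F i *: e i) = 0.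
Proof.
move=> h0; rewrite ip_sumr big_nat big1// => i iab.
by rewrite ipZr h0// mulr0.
Qed.

Lemma ip_comb_comb (F G : nat -> R) a b :
  ip (\sum_(a <= i < b) F i *: e i) (\sum_(a <= i < b) G i *: e i) =
  \sum_(a <= i < b) F i * G i * (l i != 0)%:R.
Proof.
rewrite ip_sumr; apply: eq_big_nat => i iab.
by rewrite ipZr ip_comb iab mulrCA mulrA.
Qed.

Lemma eb_comb (F : nat -> R) a b :
  A (\sum_(a <= i < b) F i *: e i) = \sum_(a <= i < b) (l i * F i) *: e i.
Proof.
rewrite (sym_sum ip_norm A_sym); apply: eq_bigr => i _.
by rewrite (symZ ip_norm A_sym) (eb_eig eb) scalerA mulrC.
Qed.

Definition eproj a b h := \sum_(a <= i < b) ip h (e i) *: e i.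

Lemma eproj_ip a b h k :
  ip (eproj a b h) (e k) = if (a <= k < b)%N then ip h (e k) else 0.
Proof.
rewrite ip_comb; case: ifP => // _.
by have [/eb_zero->|_] := eqVneq (l k) 0; rewrite ?mulr0 ?ip0r ?mulr1.
Qed.

Lemma eprojC_ip a b h k :
  ip (h - eproj a b h) (e k) = if (a <= k < b)%N then 0 else ip h (e k).
Proof. by rewrite ipBl eproj_ip; case: ifP; rewrite ?subrr ?subr0. Qed.

Lemma eproj_sym a b : symmetric_op ip (eproj a b).
Proof.
move=> u v; rewrite ip_suml ip_sumr; apply: eq_bigr => i _.
by rewrite ipZl ipZr [ip (e i) v]ipC mulrC.
Qed.

Lemma eproj_perp a b u v : ip (u - eproj a b u) (eproj a b v) = 0.
Proof. by apply: ip_perp_comb => k kab; rewrite eprojC_ip kab. Qed.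

Lemma eproj_idem a b u : eproj a b (eproj a b u) = eproj a b u.
Proof. by apply: eq_big_nat => i iab; rewrite eproj_ip iab. Qed.

Lemma eproj_pyth a b u :
  `|u| ^+ 2 = `|eproj a b u| ^+ 2 + `|u - eproj a b u| ^+ 2.
Proof.
have := eproj_perp a b u u; rewrite -!ip_norm !(ipBl, ipBr).
by rewrite (ipC ip (eproj a b u) u) => h; lra.
Qed.

Lemma eproj_le a b u : `|eproj a b u| <= `|u|.
Proof.
rewrite -ler_sqr ?nnegrE// (eproj_pyth a b u) lerDl.
by rewrite sqr_ge0.
Qed.

(** Split [y = x - eproj a b x] into the part [y1] on [e i], [i < a], where
    [A - mu] is at least [c], and the rest [y2], where it is at most [- c].
    Pairing [(A - mu) y] with [y1 - y2], which has the norm of [y], gives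
    [c * `|y| ^+ 2]; and [A - mu] maps [eproj a b x] to a vector orthogonal to
    [y1 - y2], so that [y] may be replaced by [x]. *)
Lemma spectral_gap mu c a b x : (a <= b)%N -> 0 < c ->
  (forall i, (i < a)%N -> mu + c <= l i) -> l b <= mu - c ->
  c * `|x - eproj a b x| <= `|A x - mu *: x|.
Proof.
move=> ab c0 lea geb; set y := x - _.
have [->|y0] := eqVneq y 0; first by rewrite normr0 mulr0.
pose y1 := eproj 0 a x; pose y2 := x - eproj 0 b x.
have yE : y = y1 + y2.
  by rewrite /y1/y2/y /eproj (@big_cat_nat _ _ _ a 0 b)//= opprD addrCA addNKr.
have y2e k : (k < b)%N -> ip y2 (e k) = 0 by move=> kb; rewrite eprojC_ip kb.
have y2y1 (F : nat -> R) : ip (\sum_(0 <= i < a) F i *: e i) y2 = 0.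
  rewrite ipC; apply: ip_perp_comb => k /= ka.
  by rewrite y2e// (leq_trans ka).
have y12 : ip y1 y2 = 0 by exact: y2y1.
have Ay1y2 : ip (A y1) y2 = 0 by rewrite eb_comb.
have Ay2y1 : ip (A y2) y1 = 0 by rewrite A_sym ipC.
have yy : `|y| ^+ 2 = `|y1| ^+ 2 + `|y2| ^+ 2.
  by rewrite yE (normD_orth ip_norm y12).
pose z := y1 - y2.
have zz : `|z| = `|y|.
  by apply/eqP; rewrite -(@eqrXn2 _ 2)// yy (normB_orth ip_norm y12).
have q1 : (mu + c) * `|y1| ^+ 2 <= ip (A y1) y1.
  rewrite eb_comb -ip_norm !ip_comb_comb mulr_sumr big_nat [leRHS]big_nat.
  apply: ler_sum => i /= ia; rewrite -!mulrA ler_wpM2r ?lea//.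
  by rewrite mulrA mulr_ge0// -expr2 sqr_ge0.
have q2 : ip (A y2) y2 <= (mu - c) * `|y2| ^+ 2.
  by rewrite (le_trans (eb_rayleigh eb y2e))// ler_wpM2r ?sqr_ge0.
have ze k : (a <= k < b)%N -> ip z (e k) = 0.
  move=> /andP[ak kb]; rewrite ipBl y2e// subr0 eproj_ip ifF//.
  by rewrite ltnNge ak.
have key : c * `|y| ^+ 2 <= ip (A x - mu *: x) z.
  have -> : x = y + eproj a b x by rewrite subrK.
  have -> : ip (A (y + eproj a b x) - mu *: (y + eproj a b x)) z =
      ip (A y) z - mu * ip y z.
    rewrite (symD ip_norm A_sym) !(ipBl, ipDl, ipZl).
    rewrite eb_comb !(ipC ip _ z) !ip_perp_comb//.
    by rewrite !addr0 // mulr0 addr0.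
  have dec u v : ip (A (u + v)) (u - v) =
      ip (A u) u - ip (A v) v + ip (A v) u - ip (A u) v.
    by rewrite (symD ip_norm A_sym) ipDl !ipBr; ring.
  have decI u v : ip (u + v) (u - v) = ip u u - ip v v.
    by rewrite ipDl !ipBr (ipC ip v u); ring.
  rewrite {2 3}yE /z dec decI Ay1y2 Ay2y1 !ip_norm yy.
  by lra.
have : c * `|y| ^+ 2 <= `|A x - mu *: x| * `|y|.
  rewrite (le_trans key)// -zz (le_trans (ler_norm _))//.
  exact: CauchySchwarz.
by rewrite expr2 mulrA ler_pM2r// normr_gt0.
Qed.

(** At an exact eigenvector the lower bound of [spectral_gap] is [0]. *)
Lemma eigspace_eproj mu c a b : (a <= b)%N -> 0 < c ->
  (forall i, (i < a)%N -> mu + c <= l i) -> l b <= mu - c ->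
  forall x, A x = mu *: x -> eproj a b x = x.
Proof.
move=> ab c0 lea geb x Ax; have := spectral_gap x ab c0 lea geb.
rewrite Ax subrr normr0 pmulr_rle0// normr_le0 subr_eq0.
by move=> /eqP.
Qed.

(** Courant-Fischer: by counting dimensions, some nonzero combination of
    [e 0 .. e j] is orthogonal to the [j] vectors [b]. *)
Lemma minmax j (b : 'I_j -> H) c : 0 <= c ->
  (forall x, (forall i, ip x (b i) = 0) -> ip (A x) x <= c * `|x| ^+ 2) ->
  l j <= c.
Proof.
move=> c0 Ac; rewrite leNgt; apply/negP => clj.
have lj0 i : (i <= j)%N -> 0 < l i.
  by move=> ij; rewrite (lt_le_trans (le_lt_trans c0 clj))// (eb_noninc eb).
pose M := \matrix_(i < j.+1, k < j) ip (e i) (b k).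
have : kermx M != 0.
  rewrite kermx_eq0 /row_free neq_ltn; apply/orP; left.
  by rewrite (leq_ltn_trans (rank_leq_col _)).
move=> /rowV0Pn[v vM v0].
have {vM} vM : v *m M = 0 by apply/sub_kermxP.
pose F i := v 0 (inord i); pose x := \sum_(0 <= i < j.+1) F i *: e i.
have xb k : ip x (b k) = 0.
  rewrite ip_suml big_mkord.
  transitivity ((v *m M) 0 k); last by rewrite vM mxE.
  by rewrite mxE; apply: eq_bigr => i _; rewrite ipZl mxE /F inord_val.
have xx : ip x x = \sum_(0 <= i < j.+1) F i ^+ 2.
  rewrite ip_comb_comb big_nat [RHS]big_nat; apply: eq_bigr => i /= ij.
  by rewrite gt_eqF ?lj0// mulr1.
have x0 : 0 < ip x x.
  have [i vi] : exists i, v 0 i != 0.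
    by apply/existsP; apply: contraNT v0; rewrite negb_exists => /forallP v0;
      apply/eqP/rowP => i; rewrite mxE; apply/eqP; have := v0 i; rewrite negbK.
  rewrite xx big_mkord (bigD1 i)//= ltr_pwDl//.
    by rewrite /F inord_val exprn_even_gt0.
  by apply: sumr_ge0 => k _; rewrite sqr_ge0.
have := Ac x xb; rewrite -ip_norm => h.
have : l j * ip x x <= ip (A x) x.
  have -> : ip (A x) x = \sum_(0 <= i < j.+1) l i * F i * F i * (l i != 0)%:R.
    by rewrite eb_comb ip_comb_comb.
  rewrite xx mulr_sumr big_nat [leRHS]big_nat.
  apply: ler_sum => i /= ij; rewrite gt_eqF ?lj0// mulr1 -mulrA -expr2.
  by rewrite ler_wpM2r ?sqr_ge0// (eb_noninc eb).
by move=> /le_trans/(_ h); rewrite ler_pM2r// leNgt clj.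
Qed.

(** An approximation of rank [p] vanishes on the orthogonal of [p] vectors, so
    [minmax] bounds [l p] by the approximation error. *)
Lemma eigenvalues_vanish : finite_rank_limit ip A ->
  forall eps, 0 < eps -> exists N, l N < eps.
Proof.
move=> Af eps eps0; have [|p [a [b ab]]] := Af (eps / 2).
  by rewrite divr_gt0.
exists p; rewrite (@le_lt_trans _ _ (eps / 2))//; last by lra.
apply: (minmax (b := b)) => [|x xb]; first by rewrite ltW// divr_gt0.
rewrite (le_trans (ler_norm _))// (le_trans (CauchySchwarz ip_norm _ _))//.
rewrite expr2 mulrA ler_wpM2r//.
have := ab x; rewrite big1 ?subr0// => i _.
by rewrite xb scale0r.
Qed.

End Interval.

(** Weyl's inequality: apply [minmax] to [A] with the first [i] eigenvectors of
    [B]. *)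
Lemma weyl A B e l e' l' eps : symmetric_op ip A ->
  eigenbasis A e l -> eigenbasis B e' l' -> 0 <= eps ->
  (forall h, `|A h - B h| <= eps * `|h|) -> forall i, l i <= l' i + eps.
Proof.
move=> As eA eB eps0 AB i.
apply: (minmax As eA (b := fun k : 'I_i => e' k)).
  by rewrite addr_ge0// (eb_ge0 eB).
move=> x xe; rewrite -[A x](subrK (B x)) ipDl addrC mulrDl lerD//.
  by apply: (eb_rayleigh eB) => k ki; exact: (xe (Ordinal ki)).
rewrite (le_trans (ler_norm _))// (le_trans (CauchySchwarz ip_norm _ _))//.
by rewrite expr2 mulrA ler_wpM2r.
Qed.

(** Greedy choice: each vector maximizes the Rayleigh quotient on the
    orthogonal of the previous ones. *)
Lemma eigenbasis_exists A :
  symmetric_op ip A -> psd ip A -> finite_rank_limit ip A ->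
  exists e l, eigenbasis A e l.
Proof.
move=> As Ap Af.
pose eigs (es : seq H) : Prop := forall e, e \in es -> exists l, A e = l *: e.
pose T := {es : seq H | eigs es}.
have Tes (t : T) : forall e, e \in sval t -> exists l, A e = l *: e.
  exact: svalP t.
pose Q (t : T) (q : H * R) := [/\ 0 <= q.2, A q.1 = q.2 *: q.1,
    forall e, e \in sval t -> ip q.1 e = 0, ip q.1 q.1 = (q.2 != 0)%:R &
    forall h, (forall e, e \in sval t -> ip h e = 0) ->
      ip (A h) h <= q.2 * `|h| ^+ 2].
have /choice[step stepP] : forall t : T, exists q, Q t q.
  move=> t; have [x [l xl]] := rayleigh_max As Ap Af (Tes t).
  by exists (x, l).
have rT (t : T) : eigs (rcons (sval t) (step t).1).
  move=> e; rewrite mem_rcons inE => /predU1P[->|]; last exact: Tes.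
  by exists (step t).2; have [] := stepP t.
have t0 : eigs [::] by [].
pose es := fix es n : T :=
  if n is n'.+1 then exist eigs _ (rT (es n')) else exist eigs [::] t0.
pose e n := (step (es n)).1; pose l n := (step (es n)).2.
have esE n : sval (es n) = mkseq e n.
  by elim: n => //= n IH; rewrite mkseqS IH.
have P n := stepP (es n).
have lS n : l n.+1 <= l n.
  have [l0 Ae ee en _] := P n.+1; have [_ _ _ _ lh] := P n.
  have [->|ln0] := eqVneq (l n.+1) 0; first by have [] := P n.
  have : ip (A (e n.+1)) (e n.+1) <= l n * `|e n.+1| ^+ 2.
    apply: lh => x xn; apply: ee; rewrite /= mem_rcons inE xn orbT//.
  by rewrite -ip_norm Ae ipZl en -/(l _) ln0 !mulr1.
exists e, l; split.
- by move=> i; have [] := P i.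
- have lt i j : (i < j)%N -> ip (e j) (e i) = 0.
    move=> ij; have [_ _ + _ _] := P j; apply; rewrite esE.
    by apply/mapP; exists i => //; rewrite mem_iota.
  move=> i j; have [ij|ji|<-] := ltngtP i j => //=; [by rewrite ipC lt|by rewrite lt|].
  by have [] := P i.
- by move=> i j ij; move/nonincreasing_seqP : lS; exact.
- by move=> i; have [] := P i.
- move=> i h hi; have [_ _ _ _] := P i; apply => x; rewrite esE.
  by move=> /mapP[k]; rewrite mem_iota add0n => /= ki ->; exact: hi.
Qed.

End Spectral.

(** * Sequences of eigenvalues *)

Section Cardinality.
Local Open Scope card_scope.

Lemma card_lt (T : choiceType) (A B : set T) x m n : A `<=` B -> B x -> ~ A x ->
  A #= `I_m -> B #= `I_n -> (m < n)%N.
Proof.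
move=> AB Bx Ax Am Bn.
have Af : finite_set A by apply/finite_setP; exists m.
have Bf : finite_set B by apply/finite_setP; exists n.
rewrite -(card_fset_set Am) -(card_fset_set Bn); apply: fproper_ltn_card.
rewrite fproperE; apply/andP; split; first by rewrite -fset_set_sub.
by apply/negP; rewrite -fset_set_sub// => /(_ x Bx).
Qed.

End Cardinality.

Section Eigenvalues.
Local Open Scope card_scope.
Context {R : realType} {H : completeNormedModType R}.
Variable ip : {dot H for idfun}.
Hypothesis ip_norm : forall h : H, ip h h = `|h| ^+ 2.

Lemma has_dim_le (V : set H) p q : has_dim V p -> has_dim V q -> (p <= q)%N.
Proof.
move=> [e [ei Ve]] [f [_ Vf]]; rewrite leqNgt; apply/negP => qp.
have /choice[M eM] : forall i, exists c : 'I_q -> R, e i = \sum_k c k *: f k.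
  move=> i; suff : V (e i) by rewrite Vf.
  rewrite Ve; exists (fun k => (k == i)%:R).
  rewrite (bigD1 i)//= eqxx scale1r big1 ?addr0// => k /negbTE ->.
  by rewrite scale0r.
pose N := \matrix_(i < p, k < q) M i k.
have : kermx N != 0.
  rewrite kermx_eq0 /row_free neq_ltn; apply/orP; left.
  by rewrite (leq_ltn_trans (rank_leq_col _)).
move=> /rowV0Pn[v /sub_kermxP vN]; apply/negP; rewrite negbK.
apply/eqP/rowP => i; rewrite mxE; move: i; apply: ei.
under eq_bigr do rewrite eM scaler_sumr.
rewrite exchange_big big1// => k _.
under eq_bigr do rewrite scalerA.
rewrite -scaler_suml.
have vk : (v *m N) 0 k = 0 by rewrite vN mxE.
transitivity ((v *m N) 0 k *: f k); last by rewrite vk scale0r.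
congr (_ *: _); rewrite mxE.
by apply: eq_bigr => i _; rewrite mxE.
Qed.

Lemma has_dim_unique (V : set H) p q : has_dim V p -> has_dim V q -> p = q.
Proof. by move=> Vp Vq; apply/eqP; rewrite eqn_leq !(@has_dim_le V). Qed.

(** At the first index where two sequences differ, the larger of the two values
    is taken more often by one sequence than by the other, although both
    multiplicities are the dimension of the same eigenspace. *)
Lemma eigenvalue_sequence_unique (A : H -> H) l l' :
  is_eigenvalue_sequence A l -> is_eigenvalue_sequence A l' -> l = l'.
Proof.
have main l1 l2 i : is_eigenvalue_sequence A l1 -> is_eigenvalue_sequence A l2 ->
    (forall k, (k < i)%N -> l1 k = l2 k) -> l1 i <= l2 i.
  move=> [n1 p1 c1] [n2 p2 c2] eq12; rewrite leNgt; apply/negP => l21.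
  have m0 : l1 i != 0 by rewrite gt_eqF// (le_lt_trans (p2 i)).
  have [p dp cp] := c1 _ m0; have [q dq cq] := c2 _ m0.
  have pq := has_dim_unique dp dq.
  suff : (q < p)%N by rewrite pq ltnn.
  apply: (card_lt (x := i) _ _ _ cq cp) => //=.
  - move=> k /= l2k; have [ki|ik] := ltnP k i; first by rewrite eq12.
    by have := n2 _ _ ik; rewrite l2k leNgt l21.
  - by move=> e; rewrite e ltxx in l21.
move=> h h'; apply/funext => i.
elim/ltn_ind : i => i IH; apply/eqP; rewrite eq_le.
by rewrite !main// => k /IH.
Qed.

Section Basis.
Variables (A : H -> H) (e : nat -> H) (l : nat -> R).
Hypothesis A_sym : symmetric_op ip A.
Hypothesis A_psd : psd ip A.
Hypothesis A_lim : finite_rank_limit ip A.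
Hypothesis eb : eigenbasis ip A e l.

Let vanish := eigenvalues_vanish ip_norm A_sym eb A_lim.

(** Here [a] is the first index with [l a <= m] and [b] the first one with
    [l b < m]; they exist because [l] tends to [0]. *)
Lemma eigenvalue_window m : 0 < m -> exists a b c,
  [/\ (a <= b)%N, 0 < c, forall i, (i < a)%N -> m + c <= l i, l b <= m - c &
      forall i, l i = m <-> (a <= i < b)%N].
Proof.
move=> m0; have exb : exists N, l N < m by exact: vanish.
have exa : exists N, l N <= m by have [N /ltW] := exb; exists N.
case: (ex_minnP exa) (ex_minnP exb) => a la mina [b lb minb].
have ab : (a <= b)%N by apply: mina; exact: ltW.
have lta i : (i < a)%N -> m < l i.
  by move=> ia; rewrite ltNge; apply/negP => /mina; rewrite leqNgt ia.
exists a, b, (Num.min (m - l b) (if a is a'.+1 then l a' - m else 1)); split => //.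
- by rewrite lt_min subr_gt0 lb/=; case: (a) lta => // a' h; rewrite subr_gt0 h.
- case: (a) => // a' i; rewrite ltnS => /(eb_noninc eb) ia.
  by rewrite -lerBrDl ge_min; apply/orP; right; rewrite lerD2r.
- by rewrite lerBrDl -lerBrDr ge_min lexx.
- move=> i; split => [li|/andP[ai ib]].
    rewrite leqNgt; apply/andP; split; first by apply/negP => /lta; rewrite li ltxx.
    rewrite ltnNge; apply/negP => /(eb_noninc eb); rewrite li => h.
    by rewrite ltNge h in lb.
  apply/eqP; rewrite eq_le (le_trans (eb_noninc eb ai) la)/= leNgt.
  by apply/negP => /minb; rewrite leqNgt ib.
Qed.

Lemma psd_eigenvalue_ge0 m h : A h = m *: h -> h != 0 -> 0 <= m.
Proof.
move=> Ah h0; have := A_psd h; rewrite Ah ipZl ip_norm pmulr_lge0//.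
by rewrite exprn_gt0// normr_gt0.
Qed.

Lemma eigenbasis_eigenvalues m :
  m != 0 /\ is_eigenvalue A m <-> exists2 i, l i = m & l i != 0.
Proof.
split=> [[m0 [h h0 Ah]]|[i <- li]]; last first.
  split=> //; exists (e i); last exact: (eb_eig eb).
  apply: contra_neq li => ei; apply/eqP; rewrite -[_ == _]negbK; apply/negP => li.
  have := eb_orth eb i i; rewrite li eqxx ei ip0l => /esym/eqP.
  by rewrite oner_eq0.
have mp : 0 < m by rewrite lt0r m0 (psd_eigenvalue_ge0 Ah).
have [a [b [c [ab c0 la lb lm]]]] := eigenvalue_window mp.
have := eigspace_eproj ip_norm A_sym eb ab c0 la lb Ah.
move: ab; rewrite leq_eqVlt => /predU1P[->|ab].
  by rewrite /eproj big_geq// => /esym /eqP; rewrite (negbTE h0).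
have la_m : l a = m by apply/lm; rewrite leqnn.
by exists a; rewrite ?la_m.
Qed.

Lemma eigenbasis_sequence : is_eigenvalue_sequence A l.
Proof.
split; [exact: (eb_noninc eb)|exact: (eb_ge0 eb)|move=> m m0].
have [mp|mn] := ltP 0 m; last first.
  have noeig h : A h = m *: h -> h = 0.
    move=> Ah; apply/eqP; apply: contraT => h0.
    by have := psd_eigenvalue_ge0 Ah h0; rewrite leNgt lt_neqAle m0 mn.
  exists 0%N.
    exists (fun=> 0); split => [c _ []//|].
    apply/seteqP; split => h /=.
      by move=> /noeig->; exists (fun=> 0); rewrite big_ord0.
    move=> [c]; rewrite big_ord0 => ->.
    by rewrite /eigspace/= (sym0 ip_norm A_sym) scaler0.
  rewrite (_ : [set _ | _] = set0) ?II0//.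
  apply/seteqP; split => // i /= li; have := eb_ge0 eb i.
  by rewrite li leNgt lt_neqAle m0 mn.
have [a [b [c [ab c0 la lb lm]]]] := eigenvalue_window mp.
exists (b - a)%N.
  have ba i : (i < b - a)%N -> (a <= i + a < b)%N.
    by rewrite ltn_subRL addnC leq_addl.
  exists (fun i => e (i + a)%N); split => [f f0 i|].
    have : ip (\sum_i f i *: e (i + a)%N) (e (i + a)%N) = 0 by rewrite f0 ip0l.
    rewrite ip_suml (bigD1 i)//= ipZl (eb_orth eb) eqxx big1 ?addr0.
      by rewrite (_ : l _ = m) ?m0 ?mulr1//; apply/lm; exact: ba.
    move=> k; rewrite -(inj_eq val_inj)/= => ki.
    by rewrite ipZl (eb_orth eb) eqn_add2r (negbTE ki) mulr0.
  apply/seteqP; split => h /=.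
    move=> /(eigspace_eproj ip_norm A_sym eb ab c0 la lb) <-.
    exists (fun i => ip h (e (i + a)%N)).
    by rewrite /eproj -{1}[a]add0n big_addn big_mkord.
  move=> [f ->]; rewrite /eigspace/= (sym_sum ip_norm A_sym) scaler_sumr.
  apply: eq_bigr => i _; rewrite (symZ ip_norm A_sym) (eb_eig eb) !scalerA mulrC.
  by rewrite (_ : l _ = m)//; apply/lm; exact: ba.
rewrite (_ : [set _ | _] = (fun i => (i + a)%N) @` `I_(b - a)).
  by apply: inj_card_eq => i j _ _; exact: addIn.
apply/seteqP; split => i /=.
  move=> /lm/andP[ai ib]; exists (i - a)%N; last by rewrite subnK.
  by rewrite /= ltn_sub2r// (leq_ltn_trans ai).
move=> [k /= kba <-]; apply/lm; move: kba.
by rewrite ltn_subRL addnC leq_addl.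
Qed.

Lemma eigenbasis_lambda : lambda A = l.
Proof.
rewrite /lambda; apply: xget_unique; first exact: eigenbasis_sequence.
move=> l' /eigenvalue_sequence_unique; apply.
exact: eigenbasis_sequence.
Qed.

Lemma mu_unique j m : m != 0 -> is_eigenvalue A m ->
  [set m' | [/\ m' != 0, is_eigenvalue A m' & m < m']] #= `I_j -> mu A j = m.
Proof.
move=> m0 Am mj; apply: xget_unique => // m' [m'0 Am' m'j].
have [mm'|m'm|//] := ltgtP m m'.
  suff : (j < j)%N by rewrite ltnn.
  apply: (card_lt (x := m') _ _ _ m'j mj) => //=.
    by move=> x /= [x0 Ax m'x]; split => //; exact: lt_trans m'x.
  by move=> []; rewrite ltxx.
suff : (j < j)%N by rewrite ltnn.
apply: (card_lt (x := m) _ _ _ mj m'j) => //=.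
  by move=> x /= [x0 Ax mx]; split => //; exact: lt_trans mx.
by move=> []; rewrite ltxx.
Qed.

Lemma mu_neq0 j : mu A j != 0 -> [/\ is_eigenvalue A (mu A j), 0 < mu A j &
  [set m' | [/\ m' != 0, is_eigenvalue A m' & mu A j < m']] #= `I_j].
Proof.
rewrite /mu; case: xgetP => [m _ [m0 Am mj]|]; last by rewrite eqxx.
move=> _; split => //; have [h h0 Ah] := Am.
by rewrite lt0r m0 (psd_eigenvalue_ge0 Ah).
Qed.

(** The [j] eigenvalues above [mu A j] and [mu A j] itself are [j + 1] distinct
    values of [l], too many for the indices below [j]. *)
Lemma mu_neq0_lambda j : mu A j != 0 -> l j != 0.
Proof.
move=> mj0; have [Am m0 cj] := mu_neq0 mj0.
set m := mu A j in mj0 Am m0 cj *.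
suff : m <= l j by move=> h; rewrite gt_eqF// (lt_le_trans m0).
rewrite leNgt; apply/negP => ljm.
have sub m' : is_eigenvalue A m' -> m <= m' -> (l @` `I_j) m'.
  move=> Am' mm'; have m'0 : m' != 0 by rewrite gt_eqF// (lt_le_trans m0).
  have [i li _] := (eigenbasis_eigenvalues m').1 (conj m'0 Am').
  exists i => //=; rewrite ltnNge; apply/negP => /(eb_noninc eb).
  by rewrite li leNgt (lt_le_trans ljm).
have /finite_setP[n ln] : finite_set (l @` `I_j).
  by apply: finite_image; exact: finite_II.
have : (n <= j)%N.
  by rewrite -card_le_II -(card_le_eql ln) card_image_le.
rewrite leqNgt => /negP; apply.
apply: (card_lt (x := m) _ _ _ cj ln).
- by move=> m' [_ Am' /ltW mm']; exact: sub.
- exact: sub.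
- by move=> []; rewrite ltxx.
Qed.

Lemma mu_simple j : l j != 0 -> (forall i, (i < j)%N -> l i.+1 < l i) ->
  mu A j = l j.
Proof.
move=> lj lS.
have lt k i : (k < i)%N -> (i <= j)%N -> l i < l k.
  move=> ki ij; rewrite (le_lt_trans (eb_noninc eb ki))// lS//.
  exact: leq_trans ij.
apply: mu_unique => //.
  by have [_] := (eigenbasis_eigenvalues (l j)).2 (ex_intro2 _ _ j erefl lj).
rewrite (_ : [set _ | _] = l @` `I_j).
  apply: inj_card_eq => i k /set_mem/= ij /set_mem/= kj.
  have [ik|ki|//] := ltngtP i k.
    by have := lt _ _ ik (ltnW kj) => /[swap] ->; rewrite ltxx.
  by have := lt _ _ ki (ltnW ij) => /[swap] ->; rewrite ltxx.
apply/seteqP; split => m /=.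
  move=> [m0 Am ljm]; have [i li _] := (eigenbasis_eigenvalues m).1 (conj m0 Am).
  exists i => //=; rewrite ltnNge; apply/negP => /(eb_noninc eb).
  by rewrite li leNgt ljm.
move=> [i /= ij <-].
have li : l i != 0.
  by rewrite gt_eqF// (le_lt_trans (eb_ge0 eb j)) ?lt.
have [_ ?] := (eigenbasis_eigenvalues (l i)).2 (ex_intro2 _ _ i erefl li).
by split => //; exact: lt.
Qed.

(** By induction: if the eigenvalues before [i] are simple, then [l] decreases
    strictly up to [i], hence [mu A i = l i] and the hypothesis applies to the
    [i]-th eigenspace. *)
Lemma mu_eq_lambda j :
  (forall i, (i <= j)%N -> mu A i != 0 -> has_dim (eigspace A (mu A i)) 1) ->
  l j != 0 -> forall i, (i <= j)%N -> mu A i = l i /\ (forall k, l k = l i -> k = i).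
Proof.
move=> simp lj; elim/ltn_ind => i IH ij.
have lin : l i != 0.
  by rewrite gt_eqF// (lt_le_trans _ (eb_noninc eb ij))// lt0r lj (eb_ge0 eb).
have mui : mu A i = l i.
  apply: mu_simple => // k ki.
  have [_ inj] := IH _ ki (leq_trans (ltnW ki) ij).
  rewrite lt_neqAle (eb_noninc eb)// andbT.
  by apply/eqP => /inj /eqP; rewrite -[X in _ == X]addn0 -addn1 eqn_add2l.
split=> // k lk.
have [_ _ /(_ _ lin)[p dp cp]] := eigenbasis_sequence.
have p1 : p = 1%N.
  by apply: has_dim_unique dp _; rewrite -mui; apply: simp => //; rewrite mui.
apply/eqP; apply: contraT => ki.
suff : (1 < 1)%N by [].
rewrite p1 in cp.
apply: (card_lt (A := [set i]) (x := k) _ _ _ _ cp) => //=.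
- by move=> _ ->.
- by move=> /eqP; rewrite (negbTE ki).
- exact: card_set1.
Qed.

End Basis.
End Eigenvalues.

(** * Perturbation of eigenvalues and spectral projectors *)

Section OperatorNorm.
Context {R : realType} {H : normedModType R}.
Variable A : H -> H.

Lemma opnorm_ge0 : (0 <= opnorm A)%E.
Proof. by apply: le_ereal_inf_tmp => _ [c [c0 _] <-]; rewrite lee_fin. Qed.

Lemma opnorm_le c : 0 <= c -> (forall h, `|A h| <= c * `|h|) ->
  (opnorm A <= c%:E)%E.
Proof. by move=> c0 Ac; apply: ereal_inf_lbound; exists c. Qed.

Lemma opnorm_fin c : (forall h, `|A h| <= c * `|h|) -> 0 <= c ->
  exists r, [/\ 0 <= r, opnorm A = r%:E & forall h, `|A h| <= r * `|h|].
Proof.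
move=> Ac c0; have := opnorm_le c0 Ac; have := opnorm_ge0.
case E : (opnorm A) => [r| |]//; rewrite !lee_fin => r0 rc.
exists r; split => // h; rewrite leNgt; apply/negP => rA.
have h0 : 0 < `|h|.
  rewrite normr_gt0; apply: contraTneq rA => ->.
  by rewrite normr0 mulr0 -leNgt (le_trans (Ac 0))// normr0 mulr0.
have : ((`|A h| / `|h|)%:E <= opnorm A)%E.
  apply: le_ereal_inf_tmp => _ [q [q0 Aq] <-].
  by rewrite lee_fin ler_pdivrMr.
by rewrite E lee_fin ler_pdivrMr// leNgt rA.
Qed.

End OperatorNorm.

Section Perturbation.
Context {R : realType} {H : completeNormedModType R}.
Variable ip : {dot H for idfun}.
Hypothesis ip_norm : forall h : H, ip h h = `|h| ^+ 2.

Record positive_compact (A : H -> H) : Prop := PositiveCompact {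
  pc_sym : symmetric_op ip A ;
  pc_psd : psd ip A ;
  pc_lim : finite_rank_limit ip A }.

Lemma orthproj_eq V h p : V p -> (forall v, V v -> ip (h - p) v = 0) ->
  orthproj ip V h = p.
Proof.
move=> Vp hp; apply: xget_unique => // q [Vq hq].
apply/eqP; rewrite -subr_eq0 -normr_eq0 -sqrf_eq0 -ip_norm.
have E : q - p = (h - p) - (h - q) by rewrite opprB [RHS]addrC subrKA.
by rewrite {1}E ipBl !ipBr !hp// !hq// !subrr.
Qed.

Lemma orthproj_norm V h : `|orthproj ip V h| <= `|h|.
Proof.
rewrite /orthproj; case: xgetP => [p _ [Vp hp]|_]; last by rewrite normr0.
have E : h = (h - p) + p by rewrite subrK.
rewrite -ler_sqr ?nnegrE// {1}E (normD_orth ip_norm (hp _ Vp)).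
by rewrite lerDr sqr_ge0.
Qed.

Lemma orthproj_dist V W h : `|orthproj ip V h - orthproj ip W h| <= 2 * `|h|.
Proof.
by rewrite mulr2n mulrDl mul1r (le_trans (ler_normB _ _))// lerD ?orthproj_norm.
Qed.

Lemma eigenvalue_dist_le A C eps : positive_compact A -> positive_compact C ->
  0 <= eps -> (forall h, `|A h - C h| <= eps * `|h|) ->
  (eigenvalue_dist C A <= eps%:E)%E.
Proof.
move=> [As Ap Af] [Cs Cp Cf] eps0 AC.
have [f [m fm]] := eigenbasis_exists ip_norm As Ap Af.
have [e [l el]] := eigenbasis_exists ip_norm Cs Cp Cf.
apply: ge_ereal_sup => _ [i _ <-]; rewrite lee_fin.
rewrite (eigenbasis_lambda ip_norm As Ap Af fm).
rewrite (eigenbasis_lambda ip_norm Cs Cp Cf el).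
rewrite ler_distl lerBlDr (weyl ip_norm Cs el fm)//=; last first.
  by move=> h; rewrite distrC.
by rewrite (weyl ip_norm As fm el).
Qed.

(** Davis-Kahan.  With [P] and [Q] the projectors of [C] and [A], write
    [Q - P = Q (1 - P) - (1 - Q) P].  The range of [P] consists of approximate
    eigenvectors of [A] for [mu], which [Q] almost fixes by [spectral_gap];
    likewise for the range of [Q] and [C], which bounds [(1 - P) Q] and hence
    its adjoint [Q (1 - P)]. *)
Lemma davis_kahan A C e l f m mu a b c eps :
  symmetric_op ip A -> symmetric_op ip C ->
  eigenbasis ip A f m -> eigenbasis ip C e l ->
  (a <= b)%N -> 0 < c ->
  (forall i, (i < a)%N -> mu + c <= l i) -> l b <= mu - c ->
  (forall i, (a <= i < b)%N -> l i = mu) ->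
  0 <= eps -> eps < c / 4 -> (forall h, `|A h - C h| <= eps * `|h|) ->
  forall h, `|eproj ip f a b h - eproj ip e a b h| <= 8 / c * eps * `|h|.
Proof.
move=> As Cs fm el ab c0 la lb lab eps0 epsc AC h.
have CA x : `|C x - A x| <= eps * `|x| by rewrite distrC.
have ml i : m i <= l i + eps by exact: (weyl ip_norm As fm el).
have lm i : l i <= m i + eps by exact: (weyl ip_norm Cs el fm).
set P := eproj ip e a b; set Q := eproj ip f a b.
have CP : C (P h) = mu *: P h.
  rewrite /P /eproj (eb_comb ip_norm Cs el) scaler_sumr.
  by apply: eq_big_nat => i iab; rewrite lab// scalerA.
(* the eigenvalues of [A] outside the window stay at distance [c / 2] from [mu] *)
have h1 : `|P h - Q (P h)| <= 2 / c * eps * `|h|.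
  have c'0 : 0 < c / 2 by rewrite divr_gt0.
  have := @spectral_gap _ _ _ ip_norm A f m As fm mu (c / 2) a b (P h) ab c'0.
  rewrite -/Q -CP => gap.
  have : c / 2 * `|P h - Q (P h)| <= eps * `|h|.
    rewrite (le_trans (gap _ _))//.
    - by move=> i /la ia; have := lm i; lra.
    - by have := ml b; lra.
    - by rewrite (le_trans (AC _))// ler_wpM2l// (eproj_le ip_norm el).
  rewrite mulrC -ler_pdivlMr// => /le_trans; apply.
  by rewrite le_eqVlt; apply/orP; left; apply/eqP; field; rewrite gt_eqF.
pose z := Q (h - P h); have Qz : Q z = z by rewrite /Q/z (eproj_idem ip_norm fm).
have Az : `|A z - mu *: z| <= eps * `|z|.
  rewrite -(@ler_pXn2r _ 2) ?nnegrE ?mulr_ge0// exprMn -!ip_norm.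
  have -> : A z - mu *: z = \sum_(a <= i < b) ((m i - mu) * ip z (f i)) *: f i.
    rewrite -{1 2}Qz /Q /eproj (eb_comb ip_norm As fm) scaler_sumr -sumrB.
    by apply: eq_bigr => i _; rewrite scalerA -scalerBl mulrBl.
  have -> : ip z z = \sum_(a <= i < b) ip z (f i) * ip z (f i) * (m i != 0)%:R.
    by rewrite -{1 2}Qz (ip_comb_comb fm).
  rewrite (ip_comb_comb fm) mulr_sumr big_nat [leRHS]big_nat; apply: ler_sum => i iab.
  rewrite [leRHS]mulrA ler_wpM2r// -expr2 -(expr2 (ip _ _)) exprMn ler_wpM2r ?sqr_ge0//.
  rewrite -[leLHS]real_normK ?num_real// ler_sqr ?nnegrE// ler_norml.
  by have := ml i; have := lm i; rewrite (lab i iab) => ? ?; apply/andP; split; lra.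
have zh : `|z| <= 2 / c * eps * `|h|.
  have gap := spectral_gap ip_norm Cs el z ab c0 la lb.
  have zP : c * `|z - P z| <= 2 * eps * `|z|.
    rewrite (le_trans gap)// -[C z](subrK (A z)) -addrA.
    rewrite (le_trans (ler_normD _ _))// -mulrA mulr2n mulrDl mul1r.
    by rewrite lerD.
  have [->|z0] := eqVneq z 0.
    by rewrite normr0 !mulr_ge0 // ?invr_ge0 ltW.
  have zz : `|z| ^+ 2 <= `|h| * `|z - P z|.
    rewrite -ip_norm {1}/z (eproj_sym ip f a b) -/Q Qz.
    have -> : ip (h - P h) z = ip h (z - P z).
      by rewrite ipBl ipBr (eproj_sym ip e a b).
    by rewrite (le_trans (ler_norm _))// CauchySchwarz.
  have : c * `|z| ^+ 2 <= `|h| * (2 * eps * `|z|).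
    rewrite (le_trans (ler_wpM2l (ltW c0) zz))// mulrCA.
    by rewrite ler_wpM2l.
  rewrite expr2 !mulrA ler_pM2r ?normr_gt0// => cz.
  rewrite -(ler_pM2l c0) (le_trans cz)// le_eqVlt; apply/orP; left; apply/eqP.
  by field; rewrite gt_eqF.
have -> : Q h - P h = z - (P h - Q (P h)).
  by rewrite /z {2}/Q (symB ip_norm (eproj_sym ip f a b)) -/Q opprB addrA subrK.
rewrite (le_trans (ler_normB _ _))// (le_trans (lerD zh h1))//.
rewrite -mulrDl ler_wpM2r// -mulrDl ler_wpM2r// -mulrDl ler_wpM2r//.
  by rewrite invr_ge0 ltW.
by lra.
Qed.

Lemma specproj_eproj C e l j a b c : positive_compact C -> eigenbasis ip C e l ->
  (a <= b)%N -> 0 < c -> mu C j != 0 ->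
  (forall i, (i < a)%N -> mu C j + c <= l i) -> l b <= mu C j - c ->
  (forall i, (a <= i < b)%N -> l i = mu C j) ->
  forall h, specproj ip C j h = eproj ip e a b h.
Proof.
move=> [Cs Cp Cf] el ab c0 mu0 la lb lab h; rewrite /specproj (negbTE mu0).
apply: orthproj_eq => [|v /= Cv].
  rewrite /eigspace/= /eproj (eb_comb ip_norm Cs el) scaler_sumr.
  by apply: eq_big_nat => i iab; rewrite lab// scalerA.
rewrite -(eigspace_eproj ip_norm Cs el ab c0 la lb Cv).
exact: (eproj_perp ip_norm el).
Qed.

(** [S] is the set of indices of a cluster: the eigenvalues of [A] there may
    differ, but each of them is separated from those outside the window. *)
Lemma orthproj_span_eproj A f m a b (S : set nat) : positive_compact A ->
  eigenbasis ip A f m -> (a <= b)%N ->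
  (forall i, S i <-> (a <= i < b)%N) ->
  (exists2 c, 0 < c & forall i, S i ->
    (forall k, (k < a)%N -> m i + c <= m k) /\ m b <= m i - c) ->
  forall h, orthproj ip (lin_span (\bigcup_(i in S) eigspace A (m i))) h =
            eproj ip f a b h.
Proof.
move=> [As Ap Af] fm ab SE [c c0 mc] h; apply: orthproj_eq.
  exists (b - a)%N, (fun i => ip h (f (i + a)%N)), (fun i => f (i + a)%N).
  split=> [i|]; last by rewrite /eproj -{1}[a]add0n big_addn big_mkord.
  exists (i + a)%N; last exact: (eb_eig fm).
  by apply/SE; rewrite leq_addl/= addnC -ltn_subRL.
move=> v [n [q [v_ [vS ->]]]]; rewrite ip_sumr big1// => i _.
rewrite ipZr; have [k Sk Av] := vS i; have [mk mb] := mc _ Sk.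
rewrite -(eigspace_eproj ip_norm As fm ab c0 mk mb Av).
by rewrite (eproj_perp ip_norm fm) mulr0.
Qed.

(** For small perturbations this is [davis_kahan], [c] being the gap around
    [mu C j]; for the others the distance [2] between orthogonal projectors is
    already at most [8 / c] times the perturbation. *)
Lemma cluster_specproj_lipschitz C j : positive_compact C ->
  exists2 K, 0 <= K & forall A eps, positive_compact A -> 0 <= eps ->
    (forall h, `|A h - C h| <= eps * `|h|) ->
  forall h, `|cluster_specproj ip A C j h - specproj ip C j h| <= K * eps * `|h|.
Proof.
move=> C_pc; have [Cs Cp Cf] := C_pc.
have [mu0|mu0] := eqVneq (mu C j) 0.
  exists 0 => // A eps _ _ _ h; rewrite /specproj mu0 eqxx /cluster_specproj mu0.
  rewrite (orthproj_eq (p := 0)) ?subr0 ?normr0 ?mul0r//.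
    by exists 0%N, (fun=> 0), (fun=> 0); split; [case|rewrite big_ord0].
  move=> v [n [q [v_ [vS ->]]]]; rewrite ip_sumr big1// => i _.
  by have [k []] := vS i; rewrite eqxx.
have [e [l el]] := eigenbasis_exists ip_norm Cs Cp Cf.
have [_ mup _] := mu_neq0 ip_norm Cp mu0.
have [a [b [c [ab c0 la lb lab]]]] := eigenvalue_window ip_norm Cs Cf el mup.
exists (8 / c) => [|A eps A_pc eps0 AC h]; first by rewrite divr_ge0 ?ltW.
have [ceps|epsc] := leP (c / 4) eps.
  have : `|cluster_specproj ip A C j h - specproj ip C j h| <= 2 * `|h|.
    by rewrite /specproj (negbTE mu0) orthproj_dist.
  move=> /le_trans; apply; rewrite ler_wpM2r//.
  by rewrite mulrAC ler_pdivlMr//; lra.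
have [As Ap Af] := A_pc.
have [f [m fm]] := eigenbasis_exists ip_norm As Ap Af.
have ml i : m i <= l i + eps by exact: (weyl ip_norm As fm el).
have lm i : l i <= m i + eps.
  by apply: (weyl ip_norm Cs el fm) => // x; rewrite distrC.
rewrite (specproj_eproj C_pc el ab c0 mu0 la lb) => [|i /lab//].
rewrite /cluster_specproj (eigenbasis_lambda ip_norm As Ap Af fm).
rewrite (eigenbasis_lambda ip_norm Cs Cp Cf el).
rewrite (orthproj_span_eproj A_pc fm ab).
- by apply: (davis_kahan As Cs fm el ab c0 la lb) => // i /lab.
- by move=> i; rewrite -lab/=; split=> [[]|].
- exists (c / 2) => [|i [_ li]]; first by rewrite divr_gt0.
  split=> [k /la|]; first by have := ml i; have := lm k; lra.
  by have := lm i; have := ml b; lra.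
Qed.

Lemma uniform_gap (u : nat -> R) n : (forall i, (i < n)%N -> 0 < u i) ->
  exists2 d, 0 < d & forall i, (i < n)%N -> d <= u i.
Proof.
elim: n => [|n IH] u0; first by exists 1.
have [i iN|d d0 du] := IH; first by apply: u0; rewrite ltnS ltnW.
exists (Num.min d (u n)) => [|i]; first by rewrite lt_min d0 u0.
rewrite ltnS leq_eqVlt => /predU1P[->|/du]; first by rewrite ge_min lexx orbT.
by rewrite ge_min => ->.
Qed.

Lemma psd_ker A x : positive_compact A -> ip (A x) x <= 0 -> A x = 0.
Proof.
move=> [As Ap Af] Ax; have [c c0 Ac] := finite_rank_limit_bounded ip_norm Af.
apply/eqP; rewrite -normr_eq0 -sqrf_eq0 eq_le sqr_ge0 andbT.
rewrite (le_trans (rayleigh_norm ip_norm (h := x) (M := c) As Ap _ c0))//.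
  rewrite (le_trans (ler_norm _))// (le_trans (CauchySchwarz ip_norm _ _))//.
  by rewrite expr2 mulrA ler_wpM2r.
by rewrite pmulr_rle0.
Qed.

(** If [C] has at least [j + 1] nonzero eigenvalues, the first [j + 1] of them
    are separated by a gap that small perturbations preserve, so that
    [specproj ip A j] is the cluster projector.  If [C] has fewer, the
    hypothesis on the kernels gives [A] at most [j] nonzero eigenvalues as
    well; otherwise a tiny eigenvalue of [A] would contribute a projector of
    norm [1]. *)
Lemma specproj_lipschitz C j : positive_compact C ->
  (forall i, (i <= j)%N -> mu C i != 0 -> has_dim (eigspace C (mu C i)) 1) ->
  exists2 K, 0 <= K & forall A eps, positive_compact A ->
    (forall x, C x = 0 -> A x = 0) -> 0 <= eps ->
    (forall h, `|A h - C h| <= eps * `|h|) ->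
  forall h, `|specproj ip A j h - specproj ip C j h| <= K * eps * `|h|.
Proof.
move=> C_pc simp; have [Cs Cp Cf] := C_pc.
have [e [l el]] := eigenbasis_exists ip_norm Cs Cp Cf.
have [lj|lj] := eqVneq (l j) 0.
  have mu0 : mu C j = 0.
    apply/eqP; apply: contraT => /(mu_neq0_lambda ip_norm Cs Cp Cf el).
    by rewrite lj eqxx.
  exists 0 => // A eps A_pc CA _ _ h; have [As Ap Af] := A_pc.
  have [f [m fm]] := eigenbasis_exists ip_norm As Ap Af.
  have mj : m j = 0.
    apply/eqP; rewrite eq_le (eb_ge0 fm) andbT.
    apply: (minmax ip_norm As fm (b := fun i : 'I_j => e i)) => // x xe.
    rewrite (CA x) ?ip0l ?mul0r//; apply: psd_ker => //.
    rewrite -(mul0r (`|x| ^+ 2)) -lj (eb_rayleigh el)// => i ij.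
    exact: (xe (Ordinal ij)).
  have muA : mu A j = 0.
    apply/eqP; apply: contraT => /(mu_neq0_lambda ip_norm As Ap Af fm).
    by rewrite mj eqxx.
  by rewrite /specproj mu0 muA eqxx subrr normr0 !mul0r.
have muE := mu_eq_lambda ip_norm Cs Cp Cf el simp lj.
have [muj ljP] := muE j (leqnn j).
have lS i : (i < j)%N -> 0 < l i - l i.+1.
  move=> ij; rewrite subr_gt0 lt_neqAle (eb_noninc el)// andbT.
  apply/eqP => /(muE i (ltnW ij)).2 /eqP.
  by rewrite -[X in _ == X]addn0 -addn1 eqn_add2l.
have [d0 d00 d0P] := uniform_gap lS.
pose d := Num.min d0 (l j).
have dp : 0 < d by rewrite lt_min d00 lt0r lj (eb_ge0 el).
have [K K0 KP] := cluster_specproj_lipschitz j C_pc.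
exists (K + 4 / d) => [|A eps A_pc _ eps0 AC h].
  by rewrite addr_ge0// divr_ge0// ltW.
have [deps|epsd] := leP (d / 2) eps.
  have : `|specproj ip A j h - specproj ip C j h| <= 2 * `|h|.
    rewrite /specproj muj (negbTE lj); case: ifP => _; last exact: orthproj_dist.
    rewrite sub0r normrN (le_trans (orthproj_norm _ _))//.
    by rewrite ler_peMl// ler1n.
  move=> /le_trans; apply; rewrite ler_wpM2r// mulrDl ler_wpDl ?mulr_ge0//.
  by rewrite mulrAC ler_pdivlMr//; lra.
have [As Ap Af] := A_pc.
have [f [m fm]] := eigenbasis_exists ip_norm As Ap Af.
have ml i : m i <= l i + eps by exact: (weyl ip_norm As fm el).
have lm i : l i <= m i + eps.
  by apply: (weyl ip_norm Cs el fm) => // x; rewrite distrC.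
have dd0 : d <= d0 by rewrite ge_min lexx.
have dlj : d <= l j by rewrite ge_min lexx orbT.
have mj : m j != 0 by rewrite gt_eqF//; have := lm j; lra.
have muA : mu A j = m j.
  apply: (mu_simple ip_norm As Ap Af fm mj) => i ij.
  by have := ml i.+1; have := lm i; have := d0P i ij; lra.
have <- : cluster_specproj ip A C j h = specproj ip A j h.
  rewrite /cluster_specproj /specproj muA (negbTE mj) muj.
  rewrite (eigenbasis_lambda ip_norm As Ap Af fm).
  rewrite (eigenbasis_lambda ip_norm Cs Cp Cf el).
  congr (orthproj ip _ h); apply/seteqP; split => v.
    move=> [n [q [v_ [vS ->]]]]; rewrite /eigspace/= (sym_sum ip_norm As) scaler_sumr.
    apply: eq_bigr => i _; rewrite (symZ ip_norm As).
    have [k [_ /ljP ->] Av] := vS i.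
    by rewrite Av !scalerA mulrC.
  move=> Av; exists 1%N, (fun=> 1), (fun=> v); split; first by move=> _; exists j.
  by rewrite big_ord1 scale1r.
rewrite (le_trans (KP A eps A_pc eps0 AC h))// ler_wpM2r// ler_wpM2r//.
by rewrite lerDl divr_ge0// ltW.
Qed.

End Perturbation.

(** * The maximal ergodic theorem *)

Lemma sigma_algebra_preimage_sub (T T' : Type) (f : T -> T') (G : set (set T))
    (G' : set (set T')) : (forall A, G' A -> <<s G >> (f @^-1` A)) ->
  forall A, <<s G' >> A -> <<s G >> (f @^-1` A).
Proof.
move=> GG'; apply: smallest_sub => //.
have [s0 sC sU] := smallest_sigma_algebra [set: T] G.
split=> [|A /= sA|F /= sF]; first by rewrite /= preimage_set0.
- by rewrite setTD preimage_setC -setTD; exact: sC.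
- by rewrite /= preimage_bigcup; exact: sU.
Qed.

Lemma borel_measurableP (R : realType) (A : set R) : borel A <-> measurable A.
Proof.
split; last first.
  have -> : (measurable : set (set R)) = <<s @RGenOpens.G R >>.
    exact: RGenOpens.measurableE.
  apply: smallest_sub; first exact: smallest_sigma_algebra.
  by move=> _ [a [b ->]]; apply: sub_sigma_algebra; exact: interval_open.
apply: smallest_sub => [|B oB]; last exact: open_measurable.
split => // [B mB|F mF]; first by rewrite setTD; exact: measurableC.
by apply: bigcup_measurable => n _; exact: mF.
Qed.

Section Transfer.
Context {d : measure_display} {Omega : measurableType d} {R : realType}.
Context {E F : topologicalType}.
Variables (P : probability Omega R) (X : int -> Omega -> E) (f : E -> F).
Hypothesis mf : borel_measurable f.

Lemma product_borel_comp (I : Type) (B : set (I -> F)) :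
  product_borel B -> product_borel [set x : I -> E | B (f \o x)].
Proof.
apply: (sigma_algebra_preimage_sub (f := fun x : I -> E => f \o x)).
move=> _ [i [C [bC ->]]]; apply: sub_sigma_algebra.
by exists i, (f @^-1` C); split => //; exact: mf.
Qed.

Lemma is_process_comp : is_process X -> is_process (fun t w => f (X t w)).
Proof. by move=> Xp t B /mf /(Xp t). Qed.

Lemma stationary_comp : stationary P X -> stationary P (fun t w => f (X t w)).
Proof. by move=> Xs m t s B /product_borel_comp /(Xs _ t s). Qed.

Lemma ergodic_comp : ergodic P X -> ergodic P (fun t w => f (X t w)).
Proof.
move=> Xe M /product_borel_comp /Xe + MM; apply.
by rewrite -[in RHS]MM.
Qed.

End Transfer.

Section RealProcess.
Context {d : measure_display} {Omega : measurableType d} {R : realType}.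
Variable P : probability Omega R.

Local Notation path I :=
  (g_sigma_algebraType [set A : set (I -> R) | exists (i : I) (B : set R),
    borel B /\ A = [set f | B (f i)]]).

Lemma measurable_coordinate (I : Type) (i : I) :
  measurable_fun [set: path I] (fun x => x i).
Proof.
move=> _ B /borel_measurableP bB; rewrite setTI.
by apply: sub_sigma_algebra; exists i, B.
Qed.

Variable Y : int -> Omega -> R.
Hypothesis Y_process : is_process Y.

Lemma process_measurable t : measurable_fun [set: Omega] (Y t).
Proof. by move=> _ B /borel_measurableP /Y_process; rewrite setTI; exact. Qed.

Lemma path_measurable (I : Type) (t : I -> int) :
  measurable_fun [set: Omega] (fun w => (fun i => Y (t i) w) : path I).
Proof.
apply: (measurability (rT := path I) _ erefl) => _ [_ [i [B [bB ->]]] <-].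
by rewrite setTI; exact: Y_process.
Qed.

Hypothesis Y_stationary : stationary P Y.

Lemma stationary_law m (G : path 'I_m -> R) (t : 'I_m -> int) s B :
  measurable_fun setT G -> measurable B ->
  P [set w | B (G (fun i => Y (t i + s) w))] =
  P [set w | B (G (fun i => Y (t i) w))].
Proof.
move=> mG mB; have := mG measurableT _ mB; rewrite setTI.
exact: (Y_stationary t s).
Qed.

(** Stationarity speaks of probabilities of events depending on finitely many
    coordinates, that is, of the law of [G]. *)
Lemma stationary_integral m (G : path 'I_m -> R) (t : 'I_m -> int) s
    (g : R -> \bar R) : measurable_fun setT G -> measurable_fun setT g ->
  (forall r, (0 <= g r)%E) ->
  (\int[P]_w g (G (fun i => Y (t i + s) w)) =
   \int[P]_w g (G (fun i => Y (t i) w)))%E.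
Proof.
move=> mG mg g0.
have mGY (u : 'I_m -> int) : measurable_fun [set: Omega]
    (fun w => G (fun i => Y (u i) w)).
  exact: measurableT_comp mG (path_measurable u).
pose GY u : {mfun Omega >-> R} :=
  HB.pack (fun w => G (fun i => Y (u i) w)) (isMeasurableFun.Build _ _ _ _ _ (mGY u)).
have E u : (\int[P]_w g (G (fun i => Y (u i) w)) =
    \int[pushforward P (GY u)]_r g r)%E.
  by rewrite ge0_integral_pushforward.
rewrite !E; apply: eq_measure_integral => A mA _.
apply: (@stationary_law m G t s A mG mA).
Qed.

(** The maximum of [0] and of the first [n] partial sums of [y]; the recursion
    peels off the first term, as the shift does. *)
Fixpoint max_partial_sum (n : nat) (y : nat -> R) : R :=
  if n is n'.+1 then Num.max 0 (y 0%N + max_partial_sum n' (fun i => y i.+1))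
  else 0.

Lemma max_partial_sum_ge0 n y : 0 <= max_partial_sum n y.
Proof. by case: n => [|n] //=; rewrite le_max lexx. Qed.

Lemma max_partial_sum_mono n y : max_partial_sum n y <= max_partial_sum n.+1 y.
Proof.
elim: n y => [|n IH] y; first exact: max_partial_sum_ge0.
change (Num.max 0 (y 0%N + max_partial_sum n (fun i => y i.+1)) <=
  Num.max 0 (y 0%N + max_partial_sum n.+1 (fun i => y i.+1))).
by rewrite ge_max !le_max lexx/= lerD2l IH orbT.
Qed.

Lemma max_partial_sum_ge n k y : (k <= n)%N ->
  \sum_(0 <= i < k) y i <= max_partial_sum n y.
Proof.
elim: n k y => [|n IH] [|k] y kn //; rewrite ?(big_geq (leqnn 0)).
- exact: max_partial_sum_ge0.
- exact: max_partial_sum_ge0.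
- by rewrite big_nat_recl//= le_max lerD2l IH ?orbT.
Qed.

Lemma eq_max_partial_sum n y z : (forall i, (i < n)%N -> y i = z i) ->
  max_partial_sum n y = max_partial_sum n z.
Proof.
elim: n y z => [|n IH] y z yz //=.
by rewrite yz// (IH _ (fun i => z i.+1))// => i ni; rewrite yz.
Qed.

(* a finite path is continued by [0] *)
Let ext m (x : path 'I_m) (i : nat) : R :=
  if insub i is Some k then x k else 0.

Lemma measurable_max_partial_sum m n k :
  measurable_fun setT (fun x : path 'I_m => max_partial_sum n (fun i => ext x (i + k))).
Proof.
elim: n k => [|n IH] k /=; first exact: measurable_cst.
apply: measurable_maxr; first exact: measurable_cst.
apply: measurable_funD; last first.
  rewrite [X in measurable_fun _ X](_ : _ =
      fun x => max_partial_sum n (fun i => ext x (i + k.+1))); first exact: IH.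
  apply/funext => x; apply: eq_max_partial_sum => i _.
  by rewrite addSnnS.
rewrite /ext; case: insubP => [i _ _|_]; first exact: measurable_coordinate.
exact: measurable_cst.
Qed.

Let S1 n w := max_partial_sum n (fun i => Y (1 + i%:Z) w).
Let S2 n w := max_partial_sum n (fun i => Y (1 + i%:Z + 1) w).

Let G n (x : path 'I_n) := max_partial_sum n (ext x).

Let mG n : measurable_fun setT (@G n).
Proof.
rewrite [X in measurable_fun _ X](_ : _ =
    fun x => max_partial_sum n (fun i => ext x (i + 0))).
  exact: measurable_max_partial_sum.
apply/funext => x; apply: eq_max_partial_sum => i _.
by rewrite addn0.
Qed.

Let GE n (t : nat -> int) w :
  max_partial_sum n (fun i => Y (t i) w) = G (fun i : 'I_n => Y (t i) w).
Proof.
apply: eq_max_partial_sum => i ni; rewrite /ext; case: insubP => [k _ <-//|].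
by rewrite ni.
Qed.

Let mS n t : measurable_fun setT (fun w => max_partial_sum n (fun i => Y (t i) w)).
Proof.
under eq_fun do rewrite GE.
exact: (measurableT_comp (mG (n := n)) (path_measurable (fun i : 'I_n => t i))).
Qed.

Let S1S2 n : (\int[P]_w (S2 n w)%:E = \int[P]_w (S1 n w)%:E)%E.
Proof.
have E t : (\int[P]_w (max_partial_sum n (fun i => Y (t i) w))%:E =
    \int[P]_w `|G (fun i : 'I_n => Y (t i) w)|%:E)%E.
  by apply: eq_integral => w _; rewrite -GE ger0_norm// max_partial_sum_ge0.
rewrite !E; apply: (stationary_integral (fun i : 'I_n => 1 + i%:Z) 1
  (g := fun r => `|r|%:E) (@mG n)) => //.
by apply/measurable_EFinP; exact: normr_measurable.
Qed.

Let S1S n w : S1 n.+1 w = S2 n w + Num.max (- S2 n w) (Y 1 w).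
Proof.
rewrite addr_maxr subrr [S2 n w + _]addrC; congr (Num.max 0 (_ + _)).
rewrite /S2; apply: eq_max_partial_sum => i _.
by congr (Y _ w); rewrite intS; ring.
Qed.

(** Garsia's maximal ergodic theorem.  Let [S1 n] and [S2 n] be the maximal
    partial sums of [n] terms started at [1] and at [2].  They have the same
    law, and [S1 n <= S1 n.+1 = S2 n + max (- S2 n, Y 1)], so the last term has
    nonnegative expectation; it converges to [Y 1] because [Y 1 + S2 n] is
    eventually positive. *)
Lemma maximal_ergodic : P.-integrable setT (EFin \o Y 1) ->
  {ae P, forall w, exists n, 0 < \sum_(0 <= i < n) Y (1 + i%:Z) w} ->
  (0 <= \int[P]_w (Y 1 w)%:E)%E.
Proof.
move=> iY pos.
have mY : measurable_fun setT (Y 1) by exact: process_measurable.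
have mS1 n : measurable_fun setT (S1 n) by exact: mS.
have mS2 n : measurable_fun setT (S2 n) by exact: (mS n (fun i => 1 + i%:Z + 1)).
pose U n w := Num.max (- S2 n w) (Y 1 w).
have mU n : measurable_fun setT (U n).
  by apply: measurable_maxr => //; exact: measurable_funN.
have UY n w : `|U n w| <= `|Y 1 w|.
  have := max_partial_sum_ge0 n (fun i => Y (1 + i%:Z + 1) w).
  rewrite -/(S2 n w) /U => s0.
  have [Y0|Y0] := leP 0 (Y 1 w).
    by rewrite max_r// (le_trans _ Y0)// oppr_le0.
  rewrite (ltr0_norm Y0) ler0_norm ?ge_max ?oppr_le0 ?s0 ?(ltW Y0)//.
  by rewrite lerN2 le_max lexx orbT.
have iU n : P.-integrable setT (EFin \o U n).
  apply: le_integrable iY => //; first exact/measurable_EFinP.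
  by move=> w _ /=; rewrite lee_fin UY.
have S1fin n : (\int[P]_w (S1 n w)%:E < +oo)%E.
  elim: n => [|n IH].
    by under eq_integral do rewrite /S1/=; rewrite integral0.
  apply: (@le_lt_trans _ _ (\int[P]_w ((S2 n w)%:E + `|Y 1 w|%:E))%E).
    apply: ge0_le_integral => //.
    - by move=> w _; rewrite lee_fin max_partial_sum_ge0.
    - exact/measurable_EFinP.
    - under eq_fun do rewrite -EFinD; apply/measurable_EFinP.
      by apply: measurable_funD => //; exact: measurableT_comp.
    - move=> w _; rewrite -EFinD lee_fin S1S lerD2l.
      by rewrite (le_trans (ler_norm _))// UY.
  rewrite ge0_integralD//.
  - by rewrite S1S2 lte_add_pinfty//; case/integrableP : iY.
  - by move=> w _; rewrite lee_fin max_partial_sum_ge0.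
  - exact/measurable_EFinP.
  - by apply/measurable_EFinP; exact: measurableT_comp.
have U0 n : (0 <= \int[P]_w (U n w)%:E)%E.
  have iS2 : P.-integrable setT (EFin \o S2 n).
    apply/integrableP; split; first exact/measurable_EFinP.
    under eq_integral do rewrite /= ger0_norm ?max_partial_sum_ge0//.
    by rewrite S1S2.
  have : (\int[P]_w (S1 n w)%:E <= \int[P]_w (S1 n.+1 w)%:E)%E.
    apply: ge0_le_integral => //.
    - by move=> w _; rewrite lee_fin max_partial_sum_ge0.
    - exact/measurable_EFinP.
    - exact/measurable_EFinP.
    - by move=> w _; rewrite lee_fin max_partial_sum_mono.
  have -> : (\int[P]_w (S1 n.+1 w)%:E =
      \int[P]_w (S2 n w)%:E + \int[P]_w (U n w)%:E)%E.
    rewrite -(integralD measurableT iS2 (iU n)).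
    by apply: eq_integral => w _; rewrite S1S EFinD.
  rewrite S1S2 -[X in (X <= _)%E]adde0 leeD2lE// -S1S2.
  exact: integrable_fin_num.
have Ucvg : {ae P, forall w, [set: Omega] w ->
    (U n w)%:E @[n --> \oo] --> (Y 1 w)%:E}.
  apply: filterS pos => w [k k0] _; apply: cvg_near_cst.
  case: k k0 => [|k]; first by rewrite big_geq// ltxx.
  rewrite big_nat_recl//= => k0; exists k => // n /= kn; congr EFin.
  rewrite /U max_r// lerNl -subr_ge0 opprK.
  rewrite (le_trans (ltW k0))// addrC lerD// /S2.
  apply: le_trans (max_partial_sum_ge _ kn).
  apply: ler_sum => i _; rewrite intS.
  by rewrite (_ : _ + (_ + _) = 1 + i%:Z + 1)//; ring.
have [] := dominated_convergence measurableT
  (fun n => (measurable_EFinP _ _).2 (mU n)) ((measurable_EFinP _ _).2 mY) Ucvg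
  (integrable_abse iY).
  by apply: aeW => w n _ /=; rewrite lee_fin.
move=> _ _; apply: cvge_ge.
by apply: nearW.
Qed.

Lemma stationary_integral1 t (g : R -> \bar R) : measurable_fun setT g ->
  (forall r, (0 <= g r)%E) ->
  (\int[P]_w g (Y t w) = \int[P]_w g (Y 0 w))%E.
Proof.
move=> mg g0.
have := stationary_integral (fun _ : 'I_1 => 0) t
  (measurable_coordinate (ord0 : 'I_1)) mg g0.
by under eq_integral do rewrite add0r.
Qed.

Lemma stationary_expectation t :
  (\int[P]_w (Y t w)%:E = \int[P]_w (Y 0 w)%:E)%E.
Proof.
have p u : (\int[P]_w (EFin \o Y u)^\+ w = \int[P]_w (EFin^\+ (Y u w)))%E.
  by rewrite funepos_comp.
have n u : (\int[P]_w (EFin \o Y u)^\- w = \int[P]_w (EFin^\- (Y u w)))%E.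
  by rewrite funeneg_comp.
have E u : (\int[P]_w (Y u w)%:E =
  \int[P]_w (EFin^\+ (Y u w)) - \int[P]_w (EFin^\- (Y u w)))%E.
  by rewrite -p -n; exact: integralE.
rewrite (E t) (E 0); congr (_ - _)%E.
  by apply: stationary_integral1 => //; exact: measurable_funepos.
by apply: stationary_integral1 => //; exact: measurable_funeneg.
Qed.

Lemma stationary_integrable t : P.-integrable setT (EFin \o Y 0) ->
  P.-integrable setT (EFin \o Y t).
Proof.
move=> /integrableP[_ iY]; apply/integrableP; split.
  by apply/measurable_EFinP; exact: process_measurable.
move: iY; rewrite (stationary_integral1 t (g := fun r => `|r%:E|%E))//.
exact: measurableT_comp.
Qed.

End RealProcess.

Section UpperErgodic.
Context {R : realType}.

Local Notation psum n x := (\sum_(0 <= i < n) x (1 + i%:Z)).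

(** Unlike positivity of some partial sum, this property is invariant under
    the shift. *)
Definition unbounded_sums : set (int -> R) :=
  [set x | forall K : nat, exists n, K%:R < psum n x].

Lemma unbounded_sums_shift :
  left_shift @^-1` unbounded_sums = unbounded_sums.
Proof.
have E n (x : int -> R) : psum n.+1 x = x 1 + psum n (left_shift x).
  rewrite big_nat_recl//= addr0; congr (_ + _); apply: eq_bigr => i _.
  by rewrite /left_shift; congr x; rewrite intS; ring.
apply/seteqP; split => x /= xu K.
  have [n xn] := xu (Num.bound (K%:R + `|x 1|)).
  exists n.+1; rewrite E -ltrBlDl (le_lt_trans _ xn)//.
  rewrite (@le_trans _ _ (K%:R + `|x 1|))//; first by rewrite lerD2l ler_normr lexx orbT.
  by rewrite ltW// archi_boundP// addr_ge0.
have [n] := xu (Num.bound (K%:R + `|x 1|)).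
case: n => [|n]; first by rewrite big_geq// ltrn0.
rewrite E => xn; exists n; rewrite -(ltrD2l (x 1)) (le_lt_trans _ xn)//.
rewrite addrC (@le_trans _ _ (K%:R + `|x 1|))//; first by rewrite lerD2l ler_norm.
by rewrite ltW// archi_boundP// addr_ge0.
Qed.

Lemma unbounded_sums_borel : product_borel unbounded_sums.
Proof.
have -> : unbounded_sums =
    \bigcap_(K in [set: nat]) \bigcup_(n in [set: nat])
      [set x : int -> R | K%:R < psum n x].
  apply/seteqP; split => x /=; first by move=> xu K _; have [n] := xu K; exists n.
  by move=> xu K; have [n _] := xu K I; exists n.
pose W := g_sigma_algebraType [set A : set (int -> R) | exists (i : int) (B : set R),
    borel B /\ A = [set f | B (f i)]].
have mS n : measurable_fun [set: W] (fun x : W => psum n x).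
  by apply: measurable_sum => i; exact: measurable_coordinate.
apply: (@bigcap_measurable _ W) => // K _.
apply: (@bigcup_measurable _ W) => n _.
have := mS n measurableT [set r | K%:R < r]; rewrite setTI; apply.
rewrite (_ : [set _ | _] = `]K%:R, +oo[%classic)//.
by apply/seteqP; split => r /=; rewrite in_itv/= andbT.
Qed.

Context {d : measure_display} {Omega : measurableType d}.
Variables (P : probability Omega R) (Y : int -> Omega -> R).
Hypothesis Y_process : is_process Y.
Hypothesis Y_stationary : stationary P Y.
Hypothesis Y_ergodic : ergodic P Y.

(** Were the partial sums of [Y - c] unbounded above with probability [1], the
    maximal ergodic theorem would give [Y 1 - c] a nonnegative expectation; by
    ergodicity they are bounded above almost surely. *)
Lemma ergodic_upper c : P.-integrable setT (EFin \o Y 0) ->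
  (\int[P]_w (Y 0 w)%:E < c%:E)%E ->
  {ae P, forall w, exists K : nat, forall n,
    \sum_(0 <= i < n) Y (1 + i%:Z) w <= c * n%:R + K%:R}.
Proof.
move=> iY Yc.
pose Z t w := Y t w - c.
have mB : borel_measurable (fun r : R => r - c).
  move=> B /borel_measurableP mB; apply/borel_measurableP.
  have : measurable_fun setT (fun r : R => r - c : R) by exact: measurable_funB.
  by move=> /(_ measurableT _ mB); rewrite setTI.
have Zp : is_process Z := is_process_comp mB Y_process.
have Zs : stationary P Z := stationary_comp mB Y_stationary.
have Ze : ergodic P Z := ergodic_comp mB Y_ergodic.
pose A := [set w | unbounded_sums (fun t => Z t w)].
have mA : measurable A.
  have := path_measurable Zp id measurableT unbounded_sums_borel.
  by rewrite setTI.
have [A0|A1] := Ze _ unbounded_sums_borel unbounded_sums_shift.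
  exists A; split => // w /= wn; apply: contrapT => /existsNP[K Kn]; apply: wn.
  exists K => n; rewrite leNgt; apply/negP => nK; apply: Kn; exists n.
  by rewrite sumrB sumr_const_nat subn0 -[c *+ n]mulr_natr ltrBrDr addrC.
have pos : {ae P, forall w, exists n, 0 < psum n (fun t => Z t w)}.
  exists (~` A); split; first exact: measurableC.
    by rewrite probability_setC// A1 subee.
  by move=> w /= wn Aw; apply: wn; have [n] := Aw 0%N; exists n.
have iY1 := stationary_integrable Y_process Y_stationary 1 iY.
have ic : P.-integrable setT (fun=> c%:E) by exact: finite_measure_integrable_cst.
have iZ : P.-integrable setT (EFin \o Z 1).
  rewrite (_ : _ \o _ = (EFin \o Y 1) \- (fun=> c%:E))%E; last first.
    by apply/funext => w /=; rewrite EFinB.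
  exact: integrableB.
have := maximal_ergodic Zp Zs iZ pos.
under eq_integral do rewrite /Z EFinB.
rewrite integralB// stationary_expectation// integral_cst//.
rewrite (_ : (c%:E * _ = c%:E)%E); last first.
  by rewrite -[RHS]mule1; congr (_ * _)%E; exact: probability_setT.
by rewrite sube_ge0 ?leNgt ?Yc.
Qed.

End UpperErgodic.

(** * Expectations of real and of simple functions *)

Section Expectation.
Context {d : measure_display} {Omega : measurableType d} {R : realType}.
Variable P : probability Omega R.

Lemma dominated_integrable (f g : Omega -> R) : measurable_fun setT f ->
  P.-integrable setT (EFin \o g) -> (forall w, `|f w| <= g w) ->
  P.-integrable setT (EFin \o f).
Proof.
move=> mf ig fg; apply: le_integrable ig => //; first exact/measurable_EFinP.
by move=> w _ /=; rewrite lee_fin (le_trans (fg w))// ler_norm.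
Qed.

Lemma bounded_integrable (f : Omega -> R) c : measurable_fun setT f ->
  (forall w, `|f w| <= c) -> P.-integrable setT (EFin \o f).
Proof.
move=> mf; apply: dominated_integrable => //.
exact: finite_measure_integrable_cst.
Qed.

Lemma integrable_Zl (f : Omega -> R) c : P.-integrable setT (EFin \o f) ->
  P.-integrable setT (EFin \o (fun w => c * f w)).
Proof.
move=> jf; rewrite (_ : _ \o _ = (fun w => c%:E * (EFin \o f) w)%E).
  exact: integrableZl.
by apply/funext => w /=; rewrite EFinM.
Qed.

Lemma integrable_B (f g : Omega -> R) : P.-integrable setT (EFin \o f) ->
  P.-integrable setT (EFin \o g) -> P.-integrable setT (EFin \o (fun w => f w - g w)).
Proof.
move=> jf jg; rewrite (_ : _ \o _ = ((EFin \o f) \- (EFin \o g))%E).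
  exact: integrableB.
by apply/funext => w /=; rewrite EFinB.
Qed.

Lemma integrable_D (f g : Omega -> R) : P.-integrable setT (EFin \o f) ->
  P.-integrable setT (EFin \o g) -> P.-integrable setT (EFin \o (fun w => f w + g w)).
Proof.
move=> jf jg; rewrite (_ : _ \o _ = ((EFin \o f) \+ (EFin \o g))%E).
  exact: integrableD.
by apply/funext => w /=; rewrite EFinD.
Qed.

Lemma Rintegral_sum (I : Type) (s : seq I) (F : I -> Omega -> R) :
  (forall i, P.-integrable setT (EFin \o F i)) ->
  P.-integrable setT (EFin \o (fun w => \sum_(i <- s) F i w)) /\
  \int[P]_w (\sum_(i <- s) F i w) = \sum_(i <- s) \int[P]_w F i w.
Proof.
move=> iF; elim: s => [|i s [IH1 IH2]].
  split.
    rewrite (_ : _ \o _ = cst 0%E); first exact: integrable0.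
    by apply/funext => w /=; rewrite big_nil.
  rewrite big_nil; under eq_Rintegral do rewrite big_nil.
  by rewrite Rintegral_cst// mul0r.
split.
  rewrite (_ : _ \o _ = (EFin \o (fun w => F i w + \sum_(j <- s) F j w))).
    exact: integrable_D.
  by apply/funext => w /=; rewrite big_cons.
under eq_Rintegral do rewrite big_cons.
by rewrite big_cons RintegralD// IH2.
Qed.

Lemma integrable_indic_eq (T : choiceType) (s : Omega -> T) v :
  measurable (s @^-1` [set v]) ->
  P.-integrable setT (EFin \o (fun w => (s w == v)%:R : R)) /\
  \int[P]_w ((s w == v)%:R : R) = fine (P (s @^-1` [set v])).
Proof.
move=> ms.
have E : (fun w => (s w == v)%:R : R) = \1_(s @^-1` [set v]).
  apply/funext => w; rewrite indicE; congr (nat_of_bool _)%:R.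
  by apply/eqP/idP => [?|/set_mem//]; exact/mem_set.
split; first by rewrite E; apply: (bounded_integrable (c := 1)) => // w;
  rewrite indicE; case: (_ \in _); rewrite ?normr1 ?normr0.
have -> : \int[P]_w ((s w == v)%:R : R) = \int[P]_w (\1_(s @^-1` [set v]) w : R).
  by rewrite -E.
by rewrite /Rintegral integral_indic// setIT.
Qed.

(** This reduces vector-valued integrals to real ones. *)
Lemma simple_integral_scalar (V : lmodType R) (s : Omega -> V) (L : V -> R) :
  simple_function s -> (forall u v, L (u + v) = L u + L v) ->
  (forall a u, L (a *: u) = a * L u) ->
  P.-integrable setT (EFin \o (fun w => L (s w))) /\
  \int[P]_w L (s w) = L (simple_integral P s).
Proof.
move=> [fs ms] LD LZ.
have L0 : L 0 = 0 by rewrite -(scale0r 0) LZ mul0r.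
have LE : (fun w => L (s w)) =
    fun w => \sum_(v <- fset_set (range s)) L v * (s w == v)%:R.
  apply/funext => w; rewrite (bigD1_seq (s w)) ?fset_uniq//=; last first.
    by rewrite in_fset_set//; apply/mem_set; exists w.
  rewrite eqxx mulr1 big1 ?addr0// => v vw.
  by rewrite eq_sym (negbTE vw) mulr0.
have iL v := integrable_Zl (L v) (integrable_indic_eq (ms v)).1.
have [iS IS] := Rintegral_sum (fset_set (range s)) iL.
rewrite LE; split => //; rewrite IS /simple_integral fsbig_finite//=.
rewrite (big_morph L LD L0); apply: eq_bigr => v _.
by rewrite RintegralZl//; last exact: (integrable_indic_eq (ms v)).1;
  rewrite (integrable_indic_eq (ms v)).2 LZ mulrC.
Qed.

End Expectation.

Section OpnormWeak.
Context {R : realType} {H : completeNormedModType R}.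
Variable ip : {dot H for idfun}.
Hypothesis ip_norm : forall h : H, ip h h = `|h| ^+ 2.

(** The summand [1] keeps the right-hand side infinite when [opnorm A] is, even
    at [h = 0]. *)
Lemma weak_le_opnorm (A : H -> H) h g :
  (`|ip (A h) g|%:E <= (`|h| * `|g| + 1)%:E * opnorm A)%E.
Proof.
have c0 : 0 < `|h| * `|g| + 1 by rewrite ltr_wpDl// mulr_ge0.
have := opnorm_ge0 A; case E : (opnorm A) => [r| |]// r0; last first.
  by rewrite gt0_muley ?lte_fin// leey.
have [c [Ac c0']] : exists c, (forall h, `|A h| <= c * `|h|) /\ 0 <= c.
  apply: contrapT => nc.
  suff : opnorm A = +oo%E by rewrite E.
  rewrite /opnorm (_ : [set _ | _ in _] = set0) ?ereal_inf0//.
  by apply/seteqP; split => // x [c [c0' Ac] _]; apply: nc; exists c.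
have [r' [r'0 + Ar]] := opnorm_fin Ac c0'; rewrite E => -[rr'].
rewrite -EFinM lee_fin rr' (le_trans (CauchySchwarz ip_norm _ _))//.
have := Ar h; have := normr_ge0 h; have := normr_ge0 g => g0 h0 Arh.
by rewrite (le_trans (ler_wpM2r g0 Arh))//; lra.
Qed.

End OpnormWeak.

(** * Discretization of a separable Hilbert space *)

Local Notation borel_space H := (g_sigma_algebraType (@open H)).

Lemma continuous_measurable_borel (R : realType) (H : completeNormedModType R)
    (F : H -> R) : continuous F -> measurable_fun [set: borel_space H] F.
Proof.
move=> /continuousP cF _ B /borel_measurableP bB; rewrite setTI.
apply: (sigma_algebra_preimage_sub _ bB) => A oA.
by apply: sub_sigma_algebra; exact: cF.
Qed.

Lemma measurable_borel_measurable (R : realType) (H : completeNormedModType R)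
    (F : H -> R) : measurable_fun [set: borel_space H] F -> borel_measurable F.
Proof.
by move=> mF B /borel_measurableP mB; have := mF measurableT _ mB; rewrite setTI.
Qed.

Section Nearest.
Context {R : realType} {H : completeNormedModType R}.
Variable d : nat -> H.

(** Discretization of [H]: a point of the grid [0, d 0, .., d (m - 1)] nearest
    to [h].  Having [0] on the grid makes the error at most [`|h|]. *)
Fixpoint nearest m h : H :=
  if m is m'.+1 then
    if `|h - d m'| < `|h - nearest m' h| then d m' else nearest m' h
  else 0.

Fixpoint grid m : seq H := if m is m'.+1 then d m' :: grid m' else [:: 0].

Lemma nearest_grid m h : nearest m h \in grid m.
Proof.
elim: m => [|m IH] /=; first by rewrite inE.
by case: ifP => _; rewrite inE ?eqxx// IH orbT.
Qed.

Lemma nearestS m h :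
  `|h - nearest m.+1 h| = Num.min `|h - d m| `|h - nearest m h|.
Proof. by rewrite /= minElt; case: ifP. Qed.

Lemma nearest_le m h : `|h - nearest m h| <= `|h|.
Proof.
elim: m => [|m IH]; first by rewrite subr0.
by rewrite nearestS ge_min IH orbT.
Qed.

Lemma nearest_norm m h : `|nearest m h| <= 2 * `|h|.
Proof.
rewrite -[nearest m h](subKr h) (le_trans (ler_normB _ _))//.
by rewrite mulr2n mulrDl mul1r lerD2l nearest_le.
Qed.

Lemma nearest_le_grid m i h : (i < m)%N -> `|h - nearest m h| <= `|h - d i|.
Proof.
elim: m => // m IH; rewrite ltnS leq_eqVlt nearestS ge_min => /predU1P[->|/IH ->].
  by rewrite lexx.
by rewrite orbT.
Qed.

Lemma nearest_cvg h : dense (range d) ->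
  `|h - nearest m h| @[m --> \oo] --> (0 : R).
Proof.
move=> dd; apply/cvgr0Pnorm_lt => e e0.
have [||x [hx [i _ ix]]] := dd (ball h e).
- by exists h; exact: ballxx.
- exact: ball_open.
exists i.+1 => // m /= im; rewrite normr_id (le_lt_trans (nearest_le_grid h im))//.
by move: hx; rewrite ix -ball_normE.
Qed.

Lemma measurable_nearest_dist m :
  measurable_fun [set: borel_space H] (fun h => `|h - nearest m h|).
Proof.
have md x : measurable_fun [set: borel_space H] (fun h => `|h - x|).
  apply: continuous_measurable_borel => h.
  by apply: cvg_norm; apply: cvgB; [exact: cvg_id|exact: cvg_cst].
elim: m => [|m IH]; first exact: md.
under eq_fun do rewrite nearestS.
exact: measurable_minr.
Qed.

Lemma measurable_nearest m x :
  measurable ([set h | nearest m h = x] : set (borel_space H)).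
Proof.
elim: m x => [|m IH] x /=.
  have [<-|x0] := eqVneq 0 x.
    by rewrite (_ : [set _ | _] = setT)//; apply/seteqP.
  rewrite (_ : [set _ | _] = set0)//; apply/seteqP; split => // h /= e.
  by rewrite e eqxx in x0.
have md : measurable_fun [set: borel_space H] (fun h => `|h - d m|).
  apply: continuous_measurable_borel => h.
  by apply: cvg_norm; apply: cvgB; [exact: cvg_id|exact: cvg_cst].
pose B := [set h : borel_space H | `|h - d m| < `|h - nearest m h|].
have mB : measurable B.
  have := measurable_fun_ltr md (measurable_nearest_dist m) measurableT.
  move=> /(_ [set true] I); rewrite setTI.
  by rewrite (_ : _ @^-1` _ = B)//; apply/seteqP; split.
rewrite (_ : [set _ | _] =
    (B `&` [set _ | d m = x]) `|` (~` B `&` [set h | nearest m h = x])).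
  apply: measurableU; apply: measurableI => //; last exact: measurableC.
  have [<-|x0] := eqVneq (d m) x.
    by rewrite (_ : [set _ | _] = setT)//; apply/seteqP.
  rewrite (_ : [set _ | _] = set0)//; apply/seteqP; split => // h /= e.
  by rewrite e eqxx in x0.
apply/seteqP; split => h /=; rewrite /B/=.
  by case: ifPn => hd hx; [left|right; split => //; apply/negP].
by move=> [[-> //]|[/negP/negbTE ->]].
Qed.

Lemma measurable_nearest_eq m x :
  measurable_fun [set: borel_space H] (fun h => (nearest m h == x)%:R : R).
Proof.
have -> : (fun h => (nearest m h == x)%:R : R) = \1_[set h | nearest m h = x].
  apply/funext => h; rewrite indicE; congr (nat_of_bool _)%:R.
  by apply/eqP/idP => [?|/set_mem//]; exact/mem_set.
apply: measurable_indic; exact: (measurable_nearest m x).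
Qed.

(** Reduces measurability and integrals of functions of [nearest m h] to the
    indicators of the grid cells. *)
Lemma sum_nearest (V : lmodType R) m (F : H -> V) h :
  F (nearest m h) = \sum_(x <- undup (grid m)) (nearest m h == x)%:R *: F x.
Proof.
rewrite (bigD1_seq (nearest m h)) ?undup_uniq ?mem_undup ?nearest_grid//=.
rewrite eqxx scale1r big1 ?addr0// => x.
by rewrite eq_sym => /negbTE ->; rewrite scale0r.
Qed.

Variable ip : {dot H for idfun}.
Hypothesis ip_norm : forall h : H, ip h h = `|h| ^+ 2.

Lemma tensor_dist u v h :
  `|tensor ip u u h - tensor ip v v h| <= (`|u| + `|v|) * `|u - v| * `|h|.
Proof.
have -> : tensor ip u u h - tensor ip v v h = ip h u *: (u - v) + ip h (u - v) *: v.
  by rewrite /tensor scalerBr ipBr scalerBl addrA subrK.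
rewrite (le_trans (ler_normD _ _))// !normrZ.
have := CauchySchwarz ip_norm h u; have := CauchySchwarz ip_norm h (u - v).
have := normr_ge0 (u - v); have := normr_ge0 v => v0 uv0 h1 h2.
have := ler_wpM2r v0 h1; have := ler_wpM2r uv0 h2.
by lra.
Qed.

(** Bounds the operator norm of
    [tensor h h - tensor (nearest m h) (nearest m h)]. *)
Definition grid_error m h : R := 3 * (`|h| * `|h - nearest m h|).

Lemma grid_error_ge0 m h : 0 <= grid_error m h.
Proof. by rewrite /grid_error !mulr_ge0. Qed.

Lemma grid_error_le m h : grid_error m h <= 3 * `|h| ^+ 2.
Proof. by rewrite ler_wpM2l// expr2 ler_wpM2l// nearest_le. Qed.

Lemma grid_errorP m u h :
  `|tensor ip u u h - tensor ip (nearest m u) (nearest m u) h| <=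
  grid_error m u * `|h|.
Proof.
rewrite (le_trans (tensor_dist _ _ _))// ler_wpM2r// /grid_error mulrA ler_wpM2r//.
by have := nearest_norm m u; lra.
Qed.

Lemma measurable_grid_error m : measurable_fun [set: borel_space H] (grid_error m).
Proof.
apply: measurable_funM; first exact: measurable_cst.
apply: measurable_funM; last exact: measurable_nearest_dist.
by apply: continuous_measurable_borel => h; exact: norm_continuous.
Qed.

Lemma opnorm_tensor_fin u v : exists r,
  [/\ 0 <= r, opnorm (tensor ip u u - tensor ip v v) = r%:E &
   forall h, `|tensor ip u u h - tensor ip v v h| <= r * `|h|].
Proof.
apply: (opnorm_fin (A := tensor ip u u - tensor ip v v)
  (c := (`|u| + `|v|) * `|u - v|)) => [h|].
  exact: tensor_dist.
by rewrite mulr_ge0 ?addr_ge0.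
Qed.

(** The operator norm is locally Lipschitz in [u], by [tensor_dist]. *)
Lemma measurable_opnorm_tensor v : measurable_fun [set: borel_space H]
  (fun u => fine (opnorm (tensor ip u u - tensor ip v v))).
Proof.
apply: continuous_measurable_borel => u.
set k := fun u => fine _.
have kle a b : k a <= k b + (`|a| + `|b|) * `|a - b|.
  have [r [_ Er _]] := opnorm_tensor_fin a v.
  have [s [s0 Es sP]] := opnorm_tensor_fin b v.
  rewrite /k Es Er /= -lee_fin -Er; apply: opnorm_le => [|h].
    by rewrite addr_ge0// mulr_ge0// addr_ge0.
  have -> : (tensor ip a a - tensor ip v v) h =
      (tensor ip b b h - tensor ip v v h) + (tensor ip a a h - tensor ip b b h).
    by rewrite [RHS]addrC subrKA.
  by rewrite mulrDl (le_trans (ler_normD _ _))// lerD// tensor_dist.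
have c0 : 0 < 2 * `|u| + 1 by rewrite ltr_wpDl// mulr_ge0.
have /cvgrPdist_lt cu : (t @[t --> u] --> u)%classic by exact: cvg_id.
apply/cvgrPdist_lt => e e0; near=> t.
have t1 : `|u - t| < 1.
  by near: t; exact: cu.
have te : `|u - t| < e / (2 * `|u| + 1).
  by near: t; apply: cu; rewrite divr_gt0.
have tu : `|t| <= `|u| + 1.
  rewrite -[t](subKr u) (le_trans (ler_normB _ _))// lerD2l ltW//.
have K1 := kle u t; have K2 := kle t u; rewrite distrC in K2.
move: te; rewrite ltr_pdivlMr// => te.
have : (`|u| + `|t|) * `|u - t| <= `|u - t| * (2 * `|u| + 1).
  by rewrite mulrC ler_wpM2l//; lra.
move=> h; rewrite ltr_norml; apply/andP; split; lra.
Unshelve. all: by end_near. Qed.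

End Nearest.

(** * Birkhoff's ergodic theorem *)

Section Birkhoff.
Context {d : measure_display} {Omega : measurableType d} {R : realType}.
Variable P : probability Omega R.

Definition time_average (y : int -> R) n : R :=
  n%:R^-1 * \sum_(0 <= i < n) y (1 + i%:Z).

Lemma time_average_upper (Y : int -> Omega -> R) : is_process Y ->
  stationary P Y -> ergodic P Y -> P.-integrable setT (EFin \o Y 0) ->
  {ae P, forall w, forall e, 0 < e -> \forall n \near \oo,
    time_average (Y ^~ w) n <= \int[P]_w Y 0 w + e}.
Proof.
move=> Yp Ys Ye iY; set m := \int[P]_w Y 0 w.
have mE : (\int[P]_w (Y 0 w)%:E = m%:E)%E.
  by rewrite /m /Rintegral fineK//; exact: integrable_fin_num.
have : {ae P, forall w, forall k : nat, exists K : nat, forall n,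
    \sum_(0 <= i < n) Y (1 + i%:Z) w <= (m + k.+1%:R^-1) * n%:R + K%:R}.
  apply: ae_foralln => k; apply: ergodic_upper => //.
  by rewrite mE lte_fin ltrDl invr_gt0.
apply: filterS => w wP e e0.
have e2 : 0 < e / 2 by rewrite divr_gt0.
have [k _ /(_ k (leqnn k)) /= ke] := near_infty_natSinv_lt (PosNum e2).
have [K KP] := wP k.
have [N _ /(_ N (leqnn N)) /= NK] : \forall n \near \oo, K%:R / (e / 2) <= n%:R.
  exact: nbhs_infty_ger.
exists N.+1 => // n /= Nn.
have n0 : (0 < n%:R :> R) by rewrite ltr0n (leq_trans _ Nn).
rewrite /time_average mulrC ler_pdivrMr// (le_trans (KP n))//.
have KN : K%:R <= (e / 2) * n%:R.
  move: NK; rewrite ler_pdivrMr// mulrC => /le_trans; apply.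
  by rewrite ler_wpM2l ?ler_nat ?(ltW e2)// ltnW.
have : k.+1%:R^-1 * n%:R <= e / 2 * n%:R by rewrite ler_wpM2r// ltW.
move: KN; set K' := K%:R; set N' := n%:R; set k' := k.+1%:R^-1; lra.
Qed.

(** Birkhoff's ergodic theorem: the lower half is the upper one for [- Y]. *)
Lemma birkhoff (Y : int -> Omega -> R) : is_process Y ->
  stationary P Y -> ergodic P Y -> P.-integrable setT (EFin \o Y 0) ->
  {ae P, forall w, time_average (Y ^~ w) n @[n --> \oo] --> \int[P]_w Y 0 w}.
Proof.
move=> Yp Ys Ye iY.
have mN : borel_measurable (-%R : R -> R).
  move=> B /borel_measurableP mB; apply/borel_measurableP.
  have : measurable_fun setT (-%R : R -> R) by exact: oppr_measurable.
  by move=> /(_ measurableT _ mB); rewrite setTI.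
have up := time_average_upper Yp Ys Ye iY.
have iN : P.-integrable setT (EFin \o (fun w => - Y 0 w)).
  rewrite (_ : _ \o _ = EFin \o (fun w => -1 * Y 0 w)); first exact: integrable_Zl.
  by apply/funext => w /=; rewrite mulN1r.
have := time_average_upper (is_process_comp mN Yp) (stationary_comp mN Ys)
  (ergodic_comp mN Ye) iN.
apply: filterS2 up => w upw loww; apply/cvgrPdist_le => e e0.
have := upw _ e0; have := loww _ e0; apply: filterS2 => n.
have -> : \int[P]_w - Y 0 w = - \int[P]_w Y 0 w.
  under eq_Rintegral do rewrite -mulN1r.
  by rewrite RintegralZl// mulN1r.
have -> : time_average (fun t => - Y t w) n = - time_average (Y ^~ w) n.
  by rewrite /time_average sumrN mulrN.
by move=> h1 h2; rewrite ler_norml; apply/andP; split; lra.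
Qed.

End Birkhoff.

(** * The covariance operator *)

Lemma finite_rank_sum (R : realType) (H : completeNormedModType R)
    (ip : {dot H for idfun}) (I : Type) (s : seq I) (a b : I -> H) :
  exists (p : nat) (a' b' : 'I_p -> H), forall h,
    \sum_(i <- s) ip h (b i) *: a i = \sum_i ip h (b' i) *: a' i.
Proof.
exists (size s), (fun i => a (tnth (in_tuple s) i)), (fun i => b (tnth (in_tuple s) i)).
by move=> h; rewrite big_tnth.
Qed.

(** In each ball of radius [k.+1%:R^-1] around [D i] that meets [K], choose a
    point of [K]. *)
Lemma dense_sequence_in (R : realType) (H : completeNormedModType R)
    (D : nat -> H) (K : set H) : K 0 -> dense (range D) ->
  exists y : nat -> nat -> H, (forall i k, K (y i k)) /\
    forall x e, K x -> 0 < e -> exists i k, `|x - y i k| < e.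
Proof.
move=> K0 Dd.
have /choice[y yP] : forall ik : nat * nat, exists y, K y /\
    ((exists z, K z /\ `|D ik.1 - z| < ik.2.+1%:R^-1) ->
     `|D ik.1 - y| < ik.2.+1%:R^-1).
  move=> [i k]; have [[z [Kz zk]]|nz] := pselect (exists z, K z /\
    `|D i - z| < k.+1%:R^-1); first by exists z.
  by exists 0; split.
exists (fun i k => y (i, k)); split=> [i k|x e Kx e0]; first by have [] := yP (i, k).
have e2 : 0 < e / 2 by rewrite divr_gt0.
have [k _ /(_ k (leqnn k)) /= ke] := near_infty_natSinv_lt (PosNum e2).
have k0 : 0 < k.+1%:R^-1 :> R by rewrite invr_gt0.
have [||z [hz [i _ iz]]] := Dd (ball x k.+1%:R^-1).
- by exists x; exact: ballxx.
- exact: ball_open.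
exists i, k; have [_ yik] := yP (i, k).
have xi : `|x - D i| < k.+1%:R^-1 by move: hz; rewrite -iz -ball_normE.
have {yik} /= yi : `|D i - y (i, k)| < k.+1%:R^-1.
  by apply: yik; exists x; split => //=; rewrite distrC.
rewrite (le_lt_trans (ler_distD (D i) _ _))//.
rewrite (lt_trans (ltrD xi yi))// [ltRHS]splitr.
by rewrite ltrD.
Qed.

Section KernelCovariance.
Context {d : measure_display} {Omega : measurableType d} {R : realType}.
Context {H : completeNormedModType R}.
Variable ip : {dot H for idfun}.
Hypothesis ip_norm : forall h : H, ip h h = `|h| ^+ 2.
Variables (P : probability Omega R) (Z : int -> Omega -> H) (D : nat -> H).
Hypothesis D_dense : dense (range D).
Hypothesis Z_process : is_process Z.
Hypothesis Z_sq : (\int[P]_w (`|Z 0 w| ^+ 2)%:E < +oo)%E.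

Lemma borel_process_measurable (F : H -> R) t :
  measurable_fun [set: borel_space H] F ->
  measurable_fun [set: Omega] (fun w => F (Z t w)).
Proof.
move=> /measurable_borel_measurable bF.
exact: (process_measurable (is_process_comp bF Z_process)).
Qed.

Lemma ip_measurable h : measurable_fun [set: borel_space H] (fun u => ip h u).
Proof.
under eq_fun do rewrite ipC.
by apply: continuous_measurable_borel => u; apply: (cvg_ipl ip_norm); exact: cvg_id.
Qed.

Lemma integrable_sq : P.-integrable setT (EFin \o (fun w => `|Z 0 w| ^+ 2)).
Proof.
apply/integrableP; split.
  apply/measurable_EFinP.
  have mn : measurable_fun [set: Omega] (fun w => `|Z 0 w|).
    apply: (borel_process_measurable (F := fun h => `|h|)).
    by apply: continuous_measurable_borel => h; exact: norm_continuous.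
  by apply: measurable_funX.
by under eq_integral do rewrite /= ger0_norm ?sqr_ge0//.
Qed.

Lemma integrable_form h g :
  P.-integrable setT (EFin \o (fun w => ip h (Z 0 w) * ip (Z 0 w) g)).
Proof.
apply: (dominated_integrable (g := fun w => (`|h| * `|g|) * `|Z 0 w| ^+ 2)).
- under eq_fun do rewrite (ipC ip _ g).
  by apply: measurable_funM; exact: (borel_process_measurable _ (ip_measurable _)).
- exact/integrable_Zl/integrable_sq.
- move=> w; rewrite normrM.
  have := CauchySchwarz ip_norm h (Z 0 w); have := CauchySchwarz ip_norm (Z 0 w) g.
  move=> h1 h2; rewrite (le_trans (ler_pM _ _ h2 h1))//.
  by rewrite le_eqVlt; apply/orP; left; apply/eqP; ring.
Qed.

Definition cov_form h g : R := \int[P]_w (ip h (Z 0 w) * ip (Z 0 w) g).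

Lemma cov_form_sym h g : cov_form h g = cov_form g h.
Proof.
apply: eq_Rintegral => w _; rewrite mulrC [ip _ g]ipC; congr (_ * _).
exact: ipC.
Qed.

Lemma cov_form_ge0 h : 0 <= cov_form h h.
Proof.
by apply: Rintegral_ge0 => w _; rewrite [ip _ h]ipC -expr2 sqr_ge0.
Qed.

Definition grid_prob m x : R := \int[P]_w (nearest D m (Z 0 w) == x)%:R.

(** The covariance operator of [nearest D m (Z 0)], in coordinates. *)
Definition grid_cov m h : H :=
  \sum_(x <- undup (grid D m)) grid_prob m x *: (ip h x *: x).

Definition mean_grid_error m : R := \int[P]_w grid_error D m (Z 0 w).

Lemma integrable_indicator m x :
  P.-integrable setT (EFin \o (fun w => (nearest D m (Z 0 w) == x)%:R : R)).
Proof.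
apply: (@bounded_integrable _ _ _ P _ 1).
  exact: (borel_process_measurable _ (measurable_nearest_eq D m x)).
by move=> w; case: (_ == _); rewrite ?normr1 ?normr0.
Qed.

Lemma grid_cov_weak m h g :
  P.-integrable setT (EFin \o
    (fun w => ip h (nearest D m (Z 0 w)) * ip (nearest D m (Z 0 w)) g)) /\
  ip (grid_cov m h) g =
  \int[P]_w (ip h (nearest D m (Z 0 w)) * ip (nearest D m (Z 0 w)) g).
Proof.
have E : (fun w => ip h (nearest D m (Z 0 w)) * ip (nearest D m (Z 0 w)) g) =
    (fun w => \sum_(x <- undup (grid D m)) (ip h x * ip x g) *
      (nearest D m (Z 0 w) == x)%:R).
  apply/funext => w; rewrite (sum_nearest D m (fun x => ip h x * ip x g : R^o)).
  by apply: eq_bigr => x _; exact: mulrC.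
have [iS IS] := Rintegral_sum (undup (grid D m))
  (fun x => integrable_Zl (ip h x * ip x g) (integrable_indicator m x)).
rewrite E; split => //; rewrite IS ip_suml; apply: eq_bigr => x _.
rewrite RintegralZl//; last exact: integrable_indicator.
by rewrite !ipZl mulrC.
Qed.

Lemma integrable_grid_error m :
  P.-integrable setT (EFin \o (fun w => grid_error D m (Z 0 w))).
Proof.
apply: (dominated_integrable (g := fun w => 3 * `|Z 0 w| ^+ 2)).
- exact: (borel_process_measurable _ (measurable_grid_error D m)).
- exact/integrable_Zl/integrable_sq.
- by move=> w; rewrite ger0_norm ?grid_error_ge0// grid_error_le.
Qed.

Lemma mean_grid_error_ge0 m : 0 <= mean_grid_error m.
Proof. by apply: Rintegral_ge0 => w _; exact: grid_error_ge0. Qed.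

Lemma mean_grid_error_cvg : mean_grid_error m @[m --> \oo] --> 0.
Proof.
have mge m : measurable_fun [set: Omega] (EFin \o (fun w => grid_error D m (Z 0 w))).
  by case/integrableP : (integrable_grid_error m).
have mc : measurable_fun [set: Omega] (fun=> 0 : \bar R)%E.
  exact: measurable_cst.
have [] := dominated_convergence measurableT mge mc _ (integrable_Zl 3 integrable_sq) _.
- apply: aeW => w _; apply/fine_cvgP; split; first by apply: nearW.
  have : 3 * (`|Z 0 w| * `|Z 0 w - nearest D m (Z 0 w)|) @[m --> \oo] -->
      3 * (`|Z 0 w| * 0).
    apply: cvgM; first exact: cvg_cst.
    by apply: cvgM; [exact: cvg_cst|exact: nearest_cvg].
  by rewrite !mulr0.
- by apply: aeW => w m _ /=; rewrite lee_fin ger0_norm ?grid_error_ge0// grid_error_le.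
move=> _ _; rewrite integral0 => h.
exact: (fine_cvg h).
Qed.

Lemma grid_cov_dist m h g :
  `|ip (grid_cov m h) g - cov_form h g| <= mean_grid_error m * `|h| * `|g|.
Proof.
have [iv ->] := grid_cov_weak m h g.
rewrite /cov_form -RintegralB//; last exact: integrable_form.
rewrite (le_trans (le_normr_Rintegral _ _))//.
  by apply: integrable_B => //; exact: integrable_form.
rewrite /mean_grid_error -mulrA mulrC -RintegralZl//; last exact: integrable_grid_error.
apply: le_Rintegral => //.
- have /integrable_abse := integrable_B iv (integrable_form h g).
  exact.
- exact/integrable_Zl/integrable_grid_error.
- move=> w _; rewrite -!ipZl -ipBl.
  rewrite (le_trans (CauchySchwarz ip_norm _ _))// distrC.
  have := grid_errorP D ip_norm m (Z 0 w) h; rewrite /tensor => ge.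
  by rewrite (le_trans (ler_wpM2r _ ge))// [leRHS]mulrC mulrA.
Qed.

(** [C] is the expectation of [tensor ip (Z 0) (Z 0)] in the weak sense. *)
Definition weak_cov (C : H -> H) := forall h g, ip (C h) g = cov_form h g.

Lemma weak_cov_dist C m h : weak_cov C ->
  `|grid_cov m h - C h| <= mean_grid_error m * `|h|.
Proof.
move=> Cw; apply: (norm_le_ip ip_norm).
  by rewrite mulr_ge0// mean_grid_error_ge0.
by move=> g; rewrite ipBl Cw (le_trans (ler_norm _))// grid_cov_dist.
Qed.

Lemma mean_grid_error_small e : 0 < e -> exists m, mean_grid_error m <= e.
Proof.
move=> e0; have /cvgr0Pnorm_le/(_ _ e0)[N _ /(_ N (leqnn N))] := mean_grid_error_cvg.
by rewrite ger0_norm ?mean_grid_error_ge0//; exists N.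
Qed.

(** The operators [grid_cov m] form a Cauchy sequence pointwise, since they
    approximate the form uniformly on balls. *)
Lemma weak_cov_exists : exists C, weak_cov C.
Proof.
suff /choice[C CP] : forall h, exists c, forall g, ip c g = cov_form h g.
  by exists C.
move=> h.
have cauc : cauchy (grid_cov m h @[m --> \oo]).
  apply: cauchy_exP => e e0.
  have e4 : 0 < e / (2 * (`|h| + 1)) by rewrite divr_gt0// mulr_gt0// ltr_wpDl.
  have /cvgr0Pnorm_lt/(_ _ e4)[N _ NP] := mean_grid_error_cvg.
  exists (grid_cov N h); exists N => // m /= Nm; rewrite -ball_normE/=.
  have small k : (N <= k)%N -> mean_grid_error k * `|h| < e / 2.
    move=> /NP/=; rewrite ger0_norm ?mean_grid_error_ge0// invfM mulrA.
    rewrite ltr_pdivlMr ?ltr_wpDl//; apply: le_lt_trans.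
    by rewrite ler_wpM2l ?mean_grid_error_ge0// lerDl.
  rewrite (@le_lt_trans _ _ (mean_grid_error N * `|h| + mean_grid_error m * `|h|))//.
    apply: (norm_le_ip ip_norm) => [|g].
      by rewrite addr_ge0// mulr_ge0// mean_grid_error_ge0.
    rewrite ipBl -[X in X <= _](subrKA (cov_form h g)) mulrDl.
    rewrite (le_trans (ler_norm _))// (le_trans (ler_normD _ _))// lerD//.
      exact: grid_cov_dist.
    by rewrite distrC grid_cov_dist.
  by rewrite [e]splitr ltrD// small.
move: cauc => /cauchy_cvgP/cvg_ex[/= c cP].
exists c => g.
have cg : ip (grid_cov m h) g @[m --> \oo] --> ip c g.
  exact: (cvg_ipl ip_norm _ cP).
apply: (cvg_unique (@norm_hausdorff _ _) cg).
apply/cvgrPdist_le => e e0.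
have e1 : 0 < e / (`|h| * `|g| + 1).
  by rewrite divr_gt0// ltr_wpDl// mulr_ge0.
have /cvgr0Pnorm_le/(_ _ e1) := mean_grid_error_cvg; apply: filterS => m.
rewrite ger0_norm ?mean_grid_error_ge0// ler_pdivlMr ?ltr_wpDl ?mulr_ge0// => me.
rewrite distrC (le_trans (grid_cov_dist _ _ _))// (le_trans _ me)// -mulrA.
by rewrite ler_wpM2l ?mean_grid_error_ge0// lerDl.
Qed.

(** Compactness comes from the approximation by the finite-rank [grid_cov m]. *)
Lemma weak_cov_positive_compact C : weak_cov C -> positive_compact ip C.
Proof.
move=> Cw; split.
- by move=> u v; rewrite Cw cov_form_sym -Cw ipC.
- by move=> u; rewrite Cw cov_form_ge0.
- move=> e e0; have [m me] := mean_grid_error_small e0.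
  have [p [a [b ab]]] := finite_rank_sum ip (undup (grid D m))
    (fun x => grid_prob m x *: x) id.
  exists p, a, b => h; rewrite -ab.
  rewrite (_ : \sum_(i <- _) _ = grid_cov m h).
    by rewrite distrC (le_trans (weak_cov_dist _ _ Cw))// ler_wpM2r.
  by apply: eq_bigr => x _; rewrite !scalerA mulrC.
Qed.

Let Ztensor w := tensor ip (Z 0 w) (Z 0 w).

(** The functional [A |-> ip (A h) g] is dominated by [opnorm], hence passes to
    the limit in the definition of the Bochner integral, whatever the
    approximating simple functions. *)
Lemma bochner_weak_cov C :
  is_bochner_integral P (@opnorm R H) Ztensor C -> weak_cov C.
Proof.
move=> [s [ss ms is0 sC]] h g.
apply/eqP; rewrite -subr_eq0 -normr_eq0 eq_le normr_ge0 andbT.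
rewrite -lee_fin.
set c := (`|h| * `|g| + 1)%:E.
have LD (u v : H -> H) : ip ((u + v) h) g = ip (u h) g + ip (v h) g.
  by rewrite -ipDl.
have LZ a (u : H -> H) : ip ((a *: u) h) g = a * ip (u h) g by rewrite -ipZl.
have bound n : (`|ip (C h) g - cov_form h g|%:E <=
    c * opnorm (simple_integral P (s n) - C)%R +
    c * \int[P]_w opnorm (Ztensor w - s n w)%R)%E.
  have [iL IL] := simple_integral_scalar P (L := fun A => ip (A h) g) (ss n) LD LZ.
  have -> : ip (C h) g - cov_form h g =
      - ip ((simple_integral P (s n) - C) h) g -
      \int[P]_w (ip (Ztensor w h) g - ip (s n w h) g).
    rewrite RintegralB//; last first.
      rewrite (_ : _ \o _ = EFin \o (fun w => ip h (Z 0 w) * ip (Z 0 w) g)).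
        exact: integrable_form.
      by apply/funext => w /=; rewrite ipZl.
    rewrite IL (_ : \int[P]_w (ip (Ztensor w h) g) = cov_form h g).
      by rewrite ipBl; ring.
    by apply: eq_Rintegral => w _; rewrite ipZl.
  rewrite (@le_trans _ _ (`|ip ((simple_integral P (s n) - C) h) g|%:E +
      `|\int[P]_w (ip (Ztensor w h) g - ip (s n w h) g)|%:E)%E)//.
    by rewrite -EFinD lee_fin (le_trans (ler_normB _ _))// normrN.
  apply: leeD; first exact: weak_le_opnorm.
  have iB : P.-integrable setT (EFin \o (fun w => ip (Ztensor w h) g - ip (s n w h) g)).
    apply: integrable_B => //.
    rewrite (_ : _ \o _ = EFin \o (fun w => ip h (Z 0 w) * ip (Z 0 w) g)).
      exact: integrable_form.
    by apply/funext => w /=; rewrite ipZl.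
  rewrite EFin_normr_Rintegral//.
  rewrite (le_trans (le_abse_integral _ _ _))//.
    by case/integrableP : iB.
  rewrite -ge0_integralZl//.
  - apply: ge0_le_integral => //.
    + by apply: measurableT_comp => //; case/integrableP : iB.
    + by apply: measurable_funeM; exact: ms.
    + move=> w _ /=; rewrite -ipBl; exact: (weak_le_opnorm ip_norm (Ztensor w - s n w)).
  - by move=> w _; exact: opnorm_ge0.
  - by rewrite lee_fin addr_ge0// mulr_ge0.
have lim0 : (c * opnorm (simple_integral P (s n) - C)%R +
    c * \int[P]_w opnorm (Ztensor w - s n w)%R)%E @[n --> \oo] --> 0%E.
  rewrite -[0%E](adde0) -{1}(mule0 c) -{2}(mule0 c).
  by apply: cvgeD => //; apply: cvgeZl.
by apply: (cvge_ge _ lim0); apply: nearW.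
Qed.

End KernelCovariance.

(** * The law of large numbers in operator norm *)

Section LawOfLargeNumbers.
Context {d : measure_display} {Omega : measurableType d} {R : realType}.
Context {H : completeNormedModType R}.
Variable ip : {dot H for idfun}.
Hypothesis ip_norm : forall h : H, ip h h = `|h| ^+ 2.
Variables (P : probability Omega R) (Z : int -> Omega -> H) (D : nat -> H).
Hypothesis D_dense : dense (range D).
Hypothesis Z_process : is_process Z.
Hypothesis Z_sq : (\int[P]_w (`|Z 0 w| ^+ 2)%:E < +oo)%E.

Let Ztensor w := tensor ip (Z 0 w) (Z 0 w).
Let grid_tensor m w := tensor ip (nearest D m (Z 0 w)) (nearest D m (Z 0 w)).

Lemma grid_tensor_simple m : simple_function (grid_tensor m).
Proof.
have fg : finite_set [set x | x \in grid D m] by exact: finite_seq.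
split.
  apply: (@sub_finite_set _ _ ((fun x => tensor ip x x) @` [set x | x \in grid D m])).
    by move=> _ [w _ <-]; exists (nearest D m (Z 0 w)) => //=; exact: nearest_grid.
  exact: finite_image.
move=> A.
rewrite (_ : _ @^-1` _ = \bigcup_(x in [set x | x \in grid D m /\ tensor ip x x = A])
    (fun w => nearest D m (Z 0 w)) @^-1` [set x]).
  apply: fin_bigcup_measurable => [|x _].
    by apply: sub_finite_set fg => x [].
  have := Z_process 0 (measurable_nearest D m x).
  exact.
apply/seteqP; split => w /=.
  by move=> wA; exists (nearest D m (Z 0 w)) => //; split => //; exact: nearest_grid.
by move=> [x [_ xA] /= wx]; rewrite /grid_tensor wx.
Qed.

Lemma opnorm_grid_tensor m w :
  (opnorm (Ztensor w - grid_tensor m w)%R <= (grid_error D m (Z 0 w))%:E)%E.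
Proof.
apply: opnorm_le => [|h]; first exact: grid_error_ge0.
exact: grid_errorP.
Qed.

Lemma measurable_opnorm_grid_tensor m :
  measurable_fun [set: Omega] (fun w => opnorm (Ztensor w - grid_tensor m w)).
Proof.
pose k u x := fine (opnorm (tensor ip u u - tensor ip x x)).
have kE u x : opnorm (tensor ip u u - tensor ip x x) = (k u x)%:E.
  by rewrite /k; have [r [_ -> _]] := opnorm_tensor_fin ip_norm u x.
under eq_fun do rewrite kE; apply/measurable_EFinP.
apply: (borel_process_measurable Z_process (F := fun u => k u (nearest D m u))).
under eq_fun => u do rewrite (sum_nearest D m (k u : H -> R^o)).
apply: measurable_sum => x; apply: measurable_funM.
  exact: measurable_nearest_eq.
exact: measurable_opnorm_tensor.
Qed.

Lemma simple_integral_grid m : simple_integral P (grid_tensor m) = grid_cov ip P Z D m.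
Proof.
apply/funext => h; apply: (ip_inj ip_norm) => g.
have [_ <-] := simple_integral_scalar P (L := fun A : H -> H => ip (A h) g)
  (grid_tensor_simple m) (fun u v => ipDl ip _ _ _) (fun a u => ipZl ip _ _ _).
have [_ ->] := grid_cov_weak ip P D Z_process m h g.
by apply: eq_Rintegral => w _; rewrite ipZl.
Qed.

(** The functions [grid_tensor m] are admissible in the definition of the
    Bochner integral, so that [cov_op] is not a default value. *)
Lemma weak_cov_bochner C : weak_cov ip P Z C ->
  is_bochner_integral P (@opnorm R H) Ztensor C.
Proof.
move=> Cw; exists grid_tensor.
have small : (mean_grid_error P Z D m)%:E @[m --> \oo] --> 0%E.
  apply/fine_cvgP; split; first by apply: nearW.
  exact: (mean_grid_error_cvg D_dense Z_process Z_sq).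
split.
- exact: grid_tensor_simple.
- exact: measurable_opnorm_grid_tensor.
- apply: (squeeze_cvge _ (cvg_cst 0%E) small); apply: nearW => m.
  rewrite integral_ge0/=; last by move=> w _; exact: opnorm_ge0.
  rewrite /mean_grid_error /Rintegral fineK; last first.
    by apply: integrable_fin_num => //; exact: integrable_grid_error.
  apply: ge0_le_integral => //.
  + by move=> w _; exact: opnorm_ge0.
  + exact: measurable_opnorm_grid_tensor.
  + by case/integrableP : (integrable_grid_error D Z_process Z_sq m).
  + by move=> w _; exact: opnorm_grid_tensor.
- apply: (squeeze_cvge _ (cvg_cst 0%E) small); apply: nearW => m.
  rewrite opnorm_ge0/= simple_integral_grid; apply: opnorm_le => [|h].
    exact: mean_grid_error_ge0.
  exact: (weak_cov_dist ip_norm D Z_process Z_sq m h Cw).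
Qed.

Lemma cov_op_weak : weak_cov ip P Z (cov_op P Z ip id).
Proof.
apply: (bochner_weak_cov ip_norm Z_process Z_sq).
have [C Cw] := weak_cov_exists ip_norm D_dense Z_process Z_sq.
by apply: (xgetI 0 (x := C)); exact: weak_cov_bochner.
Qed.

Lemma emp_cov_opE n w h : emp_cov_op Z ip id n w h =
  n%:R^-1 *: \sum_(0 <= i < n) ip h (Z (1 + i%:Z) w) *: Z (1 + i%:Z) w.
Proof.
rewrite /emp_cov_op /tensor big_add1 /= fct_sumE; congr (_ *: _).
Qed.

Lemma emp_cov_op_weak n w h g : ip (emp_cov_op Z ip id n w h) g =
  time_average (fun t => ip h (Z t w) * ip (Z t w) g) n.
Proof.
rewrite emp_cov_opE ipZl ip_suml /time_average; congr (_ * _).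
by apply: eq_bigr => i _; rewrite ipZl.
Qed.

Lemma emp_cov_op_positive_compact n w : positive_compact ip (emp_cov_op Z ip id n w).
Proof.
split.
- move=> u v; rewrite emp_cov_op_weak ipC emp_cov_op_weak.
  rewrite /time_average; congr (_ * _); apply: eq_bigr => i _.
  by rewrite mulrC [ip v _]ipC [ip _ u]ipC.
- move=> u; rewrite emp_cov_op_weak /time_average mulr_ge0 ?invr_ge0//.
  by apply: sumr_ge0 => i _; rewrite [ip u _]ipC -expr2 sqr_ge0.
- move=> e e0; have [p [a [b ab]]] := finite_rank_sum ip (index_iota 0 n)
    (fun i => n%:R^-1 *: Z (1 + i%:Z) w) (fun i => Z (1 + i%:Z) w).
  exists p, a, b => h; rewrite -ab emp_cov_opE scaler_sumr.
  rewrite (eq_bigr (fun i => ip h (Z (1 + i%:Z) w) *: (n%:R^-1 *: Z (1 + i%:Z) w))).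
    by rewrite subrr normr0 mulr_ge0// ltW.
  by move=> i _; rewrite !scalerA mulrC.
Qed.

Let freq m x w n := time_average (fun t => (nearest D m (Z t w) == x)%:R : R) n.

(** Compare [emp_cov_op] with the empirical covariance [G] of the discretized
    process, then [G] with [grid_cov] coefficient by coefficient, then
    [grid_cov] with [C]. *)
Lemma emp_cov_op_dist C m n w h : weak_cov ip P Z C ->
  `|emp_cov_op Z ip id n w h - C h| <=
  (time_average (fun t => grid_error D m (Z t w)) n +
   \sum_(x <- undup (grid D m)) `|freq m x w n - grid_prob P Z D m x| * `|x| ^+ 2 +
   mean_grid_error P Z D m) * `|h|.
Proof.
move=> Cw.
pose G := n%:R^-1 *: \sum_(0 <= i < n)
  tensor ip (nearest D m (Z (1 + i%:Z) w)) (nearest D m (Z (1 + i%:Z) w)) h.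
have GE : G = \sum_(x <- undup (grid D m)) freq m x w n *: (ip h x *: x).
  rewrite /G.
  under eq_bigr do rewrite (sum_nearest D m (fun x => tensor ip x x h)).
  rewrite exchange_big scaler_sumr; apply: eq_bigr => x _.
  by rewrite -scaler_suml scalerA.
rewrite -[X in `|X|](subrKA G) (le_trans (ler_normD _ _))// -addrA mulrDl lerD//.
  rewrite emp_cov_opE /G -scalerBr -sumrB normrZ /time_average -mulrA.
  rewrite ger0_norm ?invr_ge0// ler_wpM2l ?invr_ge0//.
  rewrite (le_trans (ler_norm_sum _ _ _))// mulr_suml; apply: ler_sum => i _.
  exact: grid_errorP.
rewrite -[X in `|X|](subrKA (grid_cov ip P Z D m h)) (le_trans (ler_normD _ _))//.
rewrite mulrDl lerD//; last exact: weak_cov_dist.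
rewrite GE /grid_cov -sumrB (le_trans (ler_norm_sum _ _ _))// mulr_suml.
apply: ler_sum => x _; rewrite -scalerBl !normrZ -mulrA ler_wpM2l//.
by rewrite expr2 mulrAC ler_wpM2r// mulrC CauchySchwarz.
Qed.

Hypothesis Z_stationary : stationary P Z.
Hypothesis Z_ergodic : ergodic P Z.

Lemma borel_birkhoff (F : H -> R) : measurable_fun [set: borel_space H] F ->
  P.-integrable setT (EFin \o (fun w => F (Z 0 w))) ->
  {ae P, forall w, time_average (fun t => F (Z t w)) n @[n --> \oo] -->
    \int[P]_w F (Z 0 w)}.
Proof.
move=> /measurable_borel_measurable mF.
apply: birkhoff.
- exact: is_process_comp.
- exact: stationary_comp.
- exact: ergodic_comp.
Qed.

(** By [emp_cov_op_dist] it is enough to apply Birkhoff's theorem to the grid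
    error and to the indicators of the finitely many grid cells. *)
Lemma emp_cov_op_cvg C : weak_cov ip P Z C ->
  {ae P, forall w, opnorm (emp_cov_op Z ip id n w - C) @[n --> \oo] --> 0%E}.
Proof.
move=> Cw.
have ge_ae : {ae P, forall w, forall m,
    time_average (fun t => grid_error D m (Z t w)) n @[n --> \oo] -->
    mean_grid_error P Z D m}.
  apply: ae_foralln => m; apply: borel_birkhoff.
    exact: measurable_grid_error.
  exact: integrable_grid_error.
have fr_ae : {ae P, forall w, forall m i,
    freq m (nth 0 (undup (grid D m)) i) w n @[n --> \oo] -->
    grid_prob P Z D m (nth 0 (undup (grid D m)) i)}.
  apply: ae_foralln => m; apply: ae_foralln => i.
  apply: (borel_birkhoff
    (F := fun h => (nearest D m h == nth 0 (undup (grid D m)) i)%:R)).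
    exact: measurable_nearest_eq.
  exact: integrable_indicator.
apply: filterS2 ge_ae fr_ae => w gew frw.
have bound e : 0 < e -> \forall n \near \oo,
    forall h, `|(emp_cov_op Z ip id n w - C) h| <= e * `|h|.
  move=> e0.
  have e3 : 0 < e / 3 by rewrite divr_gt0.
  have [m me] := mean_grid_error_small D_dense Z_process Z_sq e3.
  have cv : (time_average (fun t => grid_error D m (Z t w)) n +
      \sum_(x <- undup (grid D m)) `|freq m x w n - grid_prob P Z D m x| * `|x| ^+ 2 +
      mean_grid_error P Z D m) @[n --> \oo] -->
      mean_grid_error P Z D m + 0 + mean_grid_error P Z D m.
    apply: cvgD; last exact: cvg_cst.
    apply: cvgD; first exact: gew.
    rewrite [X in _ --> X](_ : 0 = \sum_(x <- undup (grid D m)) (0 : R));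
      last by rewrite big1.
    rewrite !big_seq.
    under eq_fun do rewrite big_seq.
    apply: cvg_big => [|x xg]; first exact: add_continuous.
    rewrite -[X in _ --> X](mul0r (`|x| ^+ 2)).
    apply: cvgM; last exact: cvg_cst.
    have fx : freq m x w n @[n --> \oo] --> grid_prob P Z D m x.
      by have := frw m (index x (undup (grid D m))); rewrite nth_index.
    have := cvg_norm (cvgB fx (cvg_cst (grid_prob P Z D m x))).
    by rewrite subrr normr0; apply.
  move/cvgrPdist_le : cv => /(_ _ e3); apply: filterS => n.
  rewrite distrC => /ler_normlW nb h.
  rewrite (le_trans (emp_cov_op_dist m n w h Cw))// ler_wpM2r//.
  by lra.
apply/fine_cvgP; split.
  have := bound 1 ltr01; apply: filterS => n bn.
  by have [r [_ -> _]] := opnorm_fin bn ler01.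
apply/cvgr0Pnorm_le => e e0; have := bound e e0; apply: filterS => n bn.
have [r [r0 rE _]] := opnorm_fin bn (ltW e0).
by rewrite /= rE /= ger0_norm// -lee_fin -rE; apply: opnorm_le => //; exact: ltW.
Qed.

(** The expectation of [ip x (Z t) ^+ 2] is [ip (C x) x], so [Z t] is almost
    surely orthogonal to a given [x] in the kernel of [C]; a dense sequence of
    the kernel makes the exceptional set independent of [x]. *)
Lemma emp_cov_op_ker C : weak_cov ip P Z C ->
  {ae P, forall w, forall x, C x = 0 -> forall n, emp_cov_op Z ip id n w x = 0}.
Proof.
move=> Cw.
have Cs := pc_sym (weak_cov_positive_compact ip_norm D_dense Z_process Z_sq Cw).
have [y [yC yD]] := dense_sequence_in (D := D) (K := [set x | C x = 0])
  (sym0 ip_norm Cs) D_dense.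
have yZ x t : C x = 0 -> {ae P, forall w, ip x (Z t w) = 0}.
  move=> Cx.
  have mip u : measurable_fun [set: Omega] (fun w => ip x (Z u w)).
    apply: (borel_process_measurable Z_process (F := fun v => ip x v)).
    exact: ip_measurable.
  have mb := measurable_borel_measurable (ip_measurable ip_norm x).
  have : (\int[P]_w `|((ip x (Z t w)) ^+ 2)%:E| = 0)%E.
    have := stationary_integral1 (is_process_comp mb Z_process)
      (stationary_comp mb Z_stationary) t (g := fun r => `|(r ^+ 2)%:E|%E).
    move=> ->//; last first.
      apply: measurableT_comp => //; apply/measurable_EFinP.
      exact: measurable_funX.
    have := Cw x x; rewrite Cx ip0l /cov_form.
    have iF : P.-integrable setT (EFin \o (fun w => ip x (Z 0 w) * ip (Z 0 w) x)).
      exact: integrable_form.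
    rewrite /Rintegral => /esym I0.
    have IE : (\int[P]_w (ip x (Z 0 w) * ip (Z 0 w) x)%:E = 0)%E.
      by rewrite -[LHS]fineK ?I0//; exact: integrable_fin_num.
    rewrite -[RHS]IE; apply: eq_integral => w _.
    by rewrite gee0_abs ?lee_fin ?sqr_ge0// expr2 [ip (Z 0 w) x]ipC.
  move=> /(ae_eq_integral_abs P measurableT).
  move=> [|A [mA PA nA]].
    by apply/measurable_EFinP; exact: measurable_funX.
  exists A; split => // w /= wn; apply: nA => /= /(_ I) /= [] h; apply: wn.
  by apply/eqP; rewrite -sqrf_eq0 h.
have : {ae P, forall w, forall i k (n : nat), ip (y i k) (Z (1 + n%:Z) w) = 0}.
  apply: ae_foralln => i; apply: ae_foralln => k; apply: ae_foralln => n.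
  by apply: yZ; exact: yC.
apply: filterS => w wy x Cx n; rewrite emp_cov_opE big1 ?scaler0// => i _.
suff -> : ip x (Z (1 + i%:Z) w) = 0 by rewrite scale0r.
apply/eqP; rewrite -normr_le0; apply/ler_addgt0Pl => e e0; rewrite addr0.
have e1 : 0 < e / (`|Z (1 + i%:Z) w| + 1) by rewrite divr_gt0// ltr_wpDl.
have [a [b]] := yD x _ Cx e1; rewrite ltr_pdivlMr ?ltr_wpDl// => xab.
rewrite -[ip _ _]subr0 -(wy a b i) -ipBl (le_trans (CauchySchwarz ip_norm _ _))//.
by rewrite (le_trans _ (ltW xab))// ler_wpM2l// lerDl.
Qed.

End LawOfLargeNumbers.

(** * Consistency of kernel PCA *)

Lemma separable_dense_range (T : topologicalType) (x0 : T) : separable_space T ->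
  exists D : nat -> T, dense (range D).
Proof.
move=> [S [cS dS]].
have /countable_injP[f finj] := cS.
exists (fun n => xget x0 [set x | S x /\ f x = n]) => O O0 oO.
have [x [Ox Sx]] := dS O O0 oO; exists x; split => //; exists (f x) => //.
apply: xget_unique => // y [Sy fy]; apply: finj => //; exact/mem_set.
Qed.

Lemma rate_cvg0 (R : realType) (a b : nat -> \bar R) (K : R) :
  (forall n, 0 <= a n)%E -> (forall n, (0 < n)%N -> a n <= K%:E * b n)%E ->
  b n @[n --> \oo] --> 0%E -> a n @[n --> \oo] --> 0%E.
Proof.
move=> a0 ab b0; have Kb : (K%:E * b n)%E @[n --> \oo] --> 0%E.
  by rewrite -(mule0 K%:E); exact: cvgeZl.
apply: (squeeze_cvge _ (cvg_cst 0%E) Kb); exists 1%N => // n /= n0.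
by rewrite a0 ab.
Qed.

Theorem corollary24 (R : realType)
    (d : measure_display) (Omega : measurableType d) (P : probability Omega R)
    (E : topologicalType) (E_polish : polish R E)
    (X : int -> Omega -> E) (X_process : is_process X)
    (H : completeNormedModType R) (ip : {dot H for idfun})
    (ev : H -> E -> R) (k : E -> E -> R) (phi : E -> H)
    (H_rkhs : is_rkhs ip ev k phi) (H_separable : separable_space H)
    (phi_borel : borel_measurable phi)
    (phi_sqint : bochner_square_integrable P (fun w => phi (X 0 w)))
    (phi_centered : is_bochner_integral P (fun h : H => `|h|%:E)
                      (fun w => phi (X 0 w)) 0)
    (X_stationary : stationary P X) (X_ergodic : ergodic P X) :
  let C := cov_op P X ip phi in
  let Cn := emp_cov_op X ip phi in
  [/\ (* eigenvalues: convergence and rate *)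
      {ae P, forall w, (fun n => eigenvalue_dist C (Cn n w)) @ \oo --> 0%E} /\
      (exists K : R, {ae P, forall w, forall n, (0 < n)%N ->
         (eigenvalue_dist C (Cn n w) <= K%:E * opnorm (Cn n w - C)%R)%E}),
      (* spectral projectors, eigenvalues of Cn grouped as those of C *)
      forall j : nat,
        {ae P, forall w, (fun n =>
           opnorm (cluster_specproj ip (Cn n w) C j - specproj ip C j))
             @ \oo --> 0%E} /\
        (exists K : R, {ae P, forall w, forall n, (0 < n)%N ->
           (opnorm (cluster_specproj ip (Cn n w) C j - specproj ip C j)%R
              <= K%:E * opnorm (Cn n w - C)%R)%E})
    & (* j-th spectral projectors, the first j eigenvalues of C being simple *)
      forall j : nat,
        (forall i : nat, (i <= j)%N -> mu C i != 0 ->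
           has_dim (eigspace C (mu C i)) 1) ->
        {ae P, forall w, (fun n =>
           opnorm (specproj ip (Cn n w) j - specproj ip C j)) @ \oo --> 0%E} /\
        (exists K : R, {ae P, forall w, forall n, (0 < n)%N ->
           (opnorm (specproj ip (Cn n w) j - specproj ip C j)%R
              <= K%:E * opnorm (Cn n w - C)%R)%E})].
Proof.
move=> C Cn.
have [ip_norm _ _ _] := H_rkhs.
have [D D_dense] := separable_dense_range 0 H_separable.
pose Z t w := phi (X t w).
have Z_process : is_process Z := is_process_comp phi_borel X_process.
have Z_stationary : stationary P Z := stationary_comp phi_borel X_stationary.
have Z_ergodic : ergodic P Z := ergodic_comp phi_borel X_ergodic.
have Z_sq : (\int[P]_w (`|Z 0 w| ^+ 2)%:E < +oo)%E by exact: phi_sqint.2.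
have Cw : weak_cov ip P Z C := cov_op_weak ip_norm D_dense Z_process Z_sq.
have C_pc := weak_cov_positive_compact ip_norm D_dense Z_process Z_sq Cw.
have Cn_pc n w : positive_compact ip (Cn n w).
  exact: (emp_cov_op_positive_compact ip Z n w).
have dist n w : exists r, [/\ 0 <= r, opnorm (Cn n w - C) = r%:E &
    forall h, `|Cn n w h - C h| <= r * `|h|].
  have [a a0 aP] := finite_rank_limit_bounded ip_norm (pc_lim (Cn_pc n w)).
  have [b b0 bP] := finite_rank_limit_bounded ip_norm (pc_lim C_pc).
  apply: (opnorm_fin (A := Cn n w - C) (c := a + b)) => [h|]; last first.
    by rewrite addr_ge0// ltW.
  by rewrite mulrDl (le_trans (ler_normB _ _))// lerD.
have lln : {ae P, forall w, opnorm (Cn n w - C) @[n --> \oo] --> 0%E}.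
  exact: (emp_cov_op_cvg ip_norm D_dense Z_process Z_sq Z_stationary Z_ergodic).
have ker : {ae P, forall w x, C x = 0 -> forall n, Cn n w x = 0}.
  exact: (emp_cov_op_ker ip_norm D_dense Z_process Z_sq Z_stationary).
(* a bound by the perturbation yields both the rate and the convergence *)
have conclude (a : nat -> Omega -> \bar R) K : (forall n w, 0 <= a n w)%E ->
    {ae P, forall w n, (0 < n)%N -> a n w <= K%:E * opnorm (Cn n w - C)%R}%E ->
    {ae P, forall w, a n w @[n --> \oo] --> 0%E} /\
    exists K, {ae P, forall w n, (0 < n)%N ->
      a n w <= K%:E * opnorm (Cn n w - C)%R}%E.
  move=> a0 aK; split; last by exists K.
  by apply: filterS2 lln aK => w wC wK; exact: rate_cvg0 wK wC.
split.
- apply: (conclude _ 1).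
    move=> n w; apply: (@le_trans _ _ `|lambda C 0 - lambda (Cn n w) 0|%:E) => //.
    by apply: ereal_sup_ubound; exists 0%N.
  apply: aeW => w n _; have [r [r0 -> rP]] := dist n w; rewrite mul1e.
  exact: (eigenvalue_dist_le ip_norm (Cn_pc n w) C_pc r0 rP).
- move=> j; have [K K0 KP] := cluster_specproj_lipschitz ip_norm j C_pc.
  apply: (conclude _ K) => [n w|]; first exact: opnorm_ge0.
  apply: aeW => w n _; have [r [r0 -> rP]] := dist n w; rewrite -EFinM.
  apply: opnorm_le => [|h]; first exact: mulr_ge0.
  exact: (KP _ _ (Cn_pc n w) r0 rP).
- move=> j simp; have [K K0 KP] := specproj_lipschitz ip_norm C_pc simp.
  apply: (conclude _ K) => [n w|]; first exact: opnorm_ge0.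
  apply: filterS ker => w wker n _; have [r [r0 -> rP]] := dist n w.
  rewrite -EFinM; apply: opnorm_le => [|h]; first exact: mulr_ge0.
  by apply: (KP _ _ (Cn_pc n w) _ r0 rP) => x /wker.
Qed.
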